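(* Let $H(2^{\mathbb{N}})$ be the group of homeomorphisms of the Cantor set. Then: (1) $H(2^{\mathbb{N}})$ has the small index property, i.e. every subgroup of $H(2^{\mathbb{N}})$ of index less than $2^{\aleph_0}$ is open (Truss). (2) $H(2^{\mathbb{N}})$ is not a union of countably many cosets of non-open subgroups. (3) Every algebraic homomorphism from $H(2^{\mathbb{N}})$ to a separable topological group is continuous (Rosendal and Solecki). (4) Whenever $W_0\subseteq W_1\subseteq\ldots\subseteq H(2^{\mathbb{N}})=\bigcup_k W_k$, then there are $n$ and $k$ such that $H(2^{\mathbb{N}})=W_k^n$ (Droste and Göbel).
   Context: $H(2^{\mathbb{N}})$ is the group of homeomorphisms of the Cantor set $2^{\mathbb{N}}$, with its usual Polish group topology, namely the topology of uniform convergence with respect to any compatible metric on $2^{\mathbb{N}}$. A subgroup is open (non-open) if it is (is not) an open subset of $H(2^{\mathbb{N}})$. In (2) the cosets may be cosets of different non-open subgroups. In (4) the $W_k$ are subsets of $H(2^{\mathbb{N}})$ and $W_k^n$ is the set of all products of $n$ elements of $W_k$. The names in parentheses indicate earlier authors to whom the item was already known. *)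

(* Defs.v *)
From HB Require Import structures.
From mathcomp Require Import all_boot.
From mathcomp Require Import boolp classical_sets functions cardinality.
From mathcomp Require Import topology cantor.

Set Implicit Arguments.
Unset Strict Implicit.
Unset Printing Implicit Defensive.

Local Open Scope classical_set_scope.
Local Open Scope card_scope.

(* The field [homeo_inv] is determined by [homeo_fun], see [homeo_eq]. *)
Record homeo (T : topologicalType) := Homeo {
  homeo_fun :> T -> T;
  homeo_inv : T -> T;
  homeo_continuous : continuous homeo_fun;
  homeo_inv_continuous : continuous homeo_inv;
  homeo_funK : cancel homeo_fun homeo_inv;
  homeo_invK : cancel homeo_inv homeo_fun
}.

Section HomeoGroup.
Variable T : topologicalType.
Implicit Types f g h : homeo T.

Lemma homeo_eq f g : homeo_fun f = homeo_fun g -> f = g.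
Proof.
case: f g => [f f' cf cf' fK f'K] [g g' cg cg' gK g'K] /= fg.
have fg' : f' = g' by apply/funext => x; rewrite -{1}(g'K x) -fg fK.
move: cf cf' fK f'K; rewrite fg fg' => cf cf' fK f'K.
by congr Homeo; exact: Prop_irrelevance.
Qed.

Definition homeo_one : homeo T :=
  @Homeo T id id (fun x => @cvg_id _ (nbhs x)) (fun x => @cvg_id _ (nbhs x))
    (fun=> erefl) (fun=> erefl).

Definition homeo_opp f : homeo T :=
  Homeo (@homeo_inv_continuous T f) (@homeo_continuous T f)
    (@homeo_invK T f) (@homeo_funK T f).

Definition homeo_mul f g : homeo T :=
  @Homeo T (f \o g) (homeo_inv g \o homeo_inv f)
    (fun x => continuous_comp
       (@homeo_continuous T g x) (@homeo_continuous T f (g x)))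
    (fun x => continuous_comp (@homeo_inv_continuous T f x)
       (@homeo_inv_continuous T g (homeo_inv f x)))
    (can_comp (@homeo_funK T f) (@homeo_funK T g))
    (can_comp (@homeo_invK T g) (@homeo_invK T f)).

Lemma homeo_mulA : associative homeo_mul.
Proof. by move=> f g h; exact: homeo_eq. Qed.

Lemma homeo_mul1 : left_id homeo_one homeo_mul.
Proof. by move=> f; exact: homeo_eq. Qed.

Lemma homeo_mulr1 : right_id homeo_one homeo_mul.
Proof. by move=> f; exact: homeo_eq. Qed.

Lemma homeo_mulV : left_inverse homeo_one homeo_opp homeo_mul.
Proof. by move=> f; apply/homeo_eq/funext => x /=; rewrite homeo_funK. Qed.

Lemma homeo_mulrV : right_inverse homeo_one homeo_opp homeo_mul.
Proof. by move=> f; apply/homeo_eq/funext => x /=; rewrite homeo_invK. Qed.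

HB.instance Definition _ := gen_eqMixin (homeo T).
HB.instance Definition _ := gen_choiceMixin (homeo T).
HB.instance Definition _ := isGroup.Build (homeo T)
  homeo_mulA homeo_mul1 homeo_mulr1 homeo_mulV homeo_mulrV.

End HomeoGroup.

(* Topology of uniform convergence.  On a compact Hausdorff space the
   uniformity is unique, so for [cantor_space] this is uniform convergence
   with respect to any compatible metric. *)
HB.instance Definition _ (T : uniformType) := Topological.copy (homeo T)
  (@initial_topology (homeo T) {uniform T -> T} (@homeo_fun T)).

HB.mixin Record isTopologicalGroup G & Group G & Topological G := {
  mulg_continuous : continuous (fun p : G * G => (p.1 * p.2)%g);
  invg_continuous : continuous (fun x : G => (x^-1)%g)
}.

#[short(type="topologicalGroupType")]
HB.structure Definition TopologicalGroup :=
  {G of Group G & Topological G & isTopologicalGroup G}.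

Definition separable (T : topologicalType) :=
  exists2 D : set T, countable D & dense D.

Section GroupSets.
Variable G : groupType.
Implicit Types (g : G) (K A W : set G).

Definition is_subgroup K : Prop := group_closed (mem K).

Definition left_coset g K : set G := [set (g * k)%g | k in K].
Definition right_coset K g : set G := [set (k * g)%g | k in K].

Definition is_coset K A : Prop :=
  exists g, A = left_coset g K \/ A = right_coset K g.

Definition left_cosets K : set (set G) := [set left_coset g K | g in setT].

Definition index_lt_continuum K : Prop :=
  (left_cosets K #<= [set: nat -> bool]) /\
  (left_cosets K #!= [set: nat -> bool]).

Definition set_exp W (n : nat) : set G :=
  [set (\prod_(i < n) w i)%g | w in [set w : 'I_n -> G | forall i, W (w i)]].

End GroupSets.

(* Main.v *)
(* Let [V n] be the open subgroup of the homeomorphisms that fix the first [n]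
   bits of every point.  A set [S] of homeomorphisms is full on a clopen [C] if
   it realizes on [C] every element of [V n] supported in [C].  If a symmetric
   [S] is full on a [C] that meets every cylinder of level [n] in a proper
   nonempty subset, and is dense in [V n], then [S] moves [C] to a set that
   covers the complement of [C], and commutators of elements prescribed on these
   two sets yield [V M] inside [S^18] for some [M].

   For (3) and (4) fullness comes from diagonalizing over a sequence of disjoint
   clopens that shrink to points, density from Baire category for (3), and the
   finitely many double cosets of [V M] finish (4).

   For (1) and (2) let [K] be a subgroup that is not open.  If [K] is somewhere
   dense then it is not full.  Given [k] in [K] and a clopen [A], pass to the
   closed group [R] of homeomorphisms that preserve [A] and act on [k A] as the
   conjugate by [k] of their action on [A].  If [s] acts on [A] like no element
   of [K] and trivially on [k A], then [s R] misses [K], because [g k^-1 g^-1 k]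
   is equal to [s] on [A] for every [g] in [s R].  Such groups [R] still act
   richly on every cylinder, so the step can be repeated for countably many
   subgroups along a binary tree.  The resulting Cantor set of homeomorphisms
   has pairwise distinct cosets of [K], which is (1), and has nowhere dense
   intersection with each coset in (2); nowhere dense [K] are treated by Baire
   category. *)
Require Import Defs.
From HB Require Import structures.
From mathcomp Require Import all_boot.
From mathcomp Require Import mathcomp_extra boolp classical_sets functions.
From mathcomp Require Import cardinality topology cantor.

Set Implicit Arguments.
Unset Strict Implicit.
Unset Printing Implicit Defensive.

Local Open Scope classical_set_scope.
Local Open Scope card_scope.

Local Notation X := cantor_space.
Local Notation G := (homeo cantor_space).

(** * Cylinders and the topology of the Cantor space *)

Definition agree (n : nat) (x y : X) := forall i, (i < n)%N -> x i = y i.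

Lemma agree_refl n x : agree n x x. Proof. by []. Qed.

Lemma agree_sym n x y : agree n x y -> agree n y x.
Proof. by move=> xy i /xy. Qed.

Lemma agree_trans n y x z : agree n x y -> agree n y z -> agree n x z.
Proof. by move=> xy yz i lin; rewrite xy // yz. Qed.

Lemma agree_le m n x y : (m <= n)%N -> agree n x y -> agree m x y.
Proof. by move=> mn xy i im; apply: xy; exact: leq_trans mn. Qed.

Lemma agree_eq x y : (forall n, agree n x y) -> x = y.
Proof. by move=> xy; apply/funext => i; exact: (xy i.+1). Qed.

#[local] Hint Resolve agree_refl : core.

Lemma agree_mkseq n (x y : X) : agree n x y <-> mkseq x n = mkseq y n.
Proof.
split=> [xy|/(congr1 (nth false)) E i lin].
  by apply/eq_in_map => i; rewrite mem_iota => /= lin; exact: xy.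
by have := congr1 (fun f => f i) E; rewrite !nth_mkseq.
Qed.

Lemma nbhs_agree n (x : X) : nbhs x [set y | agree n x y].
Proof.
elim: n => [|n IHn]; first by apply: filterE => y i.
have nP : nbhs x [set y : X | x n = y n].
  have := @proj_continuous nat (fun=> bool) n x [set b | x n = b].
  by apply; apply/principal_filterP.
apply: filterS2 IHn nP => y xy xyn i; rewrite ltnS leq_eqVlt.
by move=> /predU1P[->//|]; exact: xy.
Qed.

Lemma entourage_agree n :
  entourage [set xy : X * X | agree n xy.1 xy.2].
Proof.
elim: n => [|n IHn]; first by apply: filterS filterT => xy _ i.
have nP : entourage [set xy : X * X | xy.1 n = xy.2 n].
  pose E : set (X * X) := [set xy : X * X | xy.1 n = xy.2 n].
  have Eent : @entourage (initial_topology (@proj nat (fun=> bool) n)) E.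
    exists diagonal; first by move=> _ [b _ <-].
    by move=> xy.
  exists E => //.
  have pE : `[< @entourage (initial_topology (@proj nat (fun=> bool) n)) E >].
    exact/asboolP.
  match goal with |- finI_from ?D ?f _ =>
    exact (@finI_from1 _ _ D f (exist _ (n, E) pE) Logic.I) end.
apply: filterS2 IHn nP => -[x y] /= xy xyn i; rewrite ltnS leq_eqVlt.
by move=> /predU1P[->//|]; exact: xy.
Qed.

Definition cont (f : X -> X) :=
  forall x n, exists m, forall y, agree m x y -> agree n (f x) (f y).

(** The filter generated by the cylinders around [x] converges to [x] in each coordinate, hence in
    the product topology. *)
Lemma nbhs_agreeP (x : X) (A : set X) :
  nbhs x A -> exists m, forall y, agree m x y -> A y.
Proof.
pose F := filter_from [set: nat] (fun m => [set y | agree m x y]).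
have FF : Filter F.
  apply: filter_from_filter; first by exists 0.
  move=> m n _ _; exists (maxn m n) => // y xy; split; apply: agree_le xy.
    exact: leq_maxl.
  exact: leq_maxr.
suff Fx : F --> x by move=> /Fx[m _ mA]; exists m => y /mA.
apply/cvg_sup => i; apply/cvg_image.
  by apply/seteqP; split=> // b _; exists (fun=> b).
move=> A' /principal_filterP A'x; rewrite nbhs_simpl /=.
exists [set z : X | A' (z i)].
  by exists i.+1 => // y /(_ i (ltnSn i)) /= <-.
apply/seteqP; split=> [_ [z ? <-] //|b Ab].
by exists (fun=> b).
Qed.

Lemma cont_continuous f : cont f -> continuous f.
Proof.
move=> cf x A /nbhs_agreeP[n nA]; have [m mP] := cf x n.
by apply: filterS (nbhs_agree m x) => y /mP /nA.
Qed.

(** Compactness, in its near-covering form, makes the modulus of continuity uniform. *)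
Lemma homeo_unif (g : G) n :
  exists m, forall x y, agree m x y -> agree n (g x) (g y).
Proof.
have /compact_near_coveringP/(_ nat \oo) := cantor_space_compact.
pose P (i : nat) (x : X) := forall y, agree i x y -> agree n (g x) (g y).
move=> /(_ P _) [x _|m _ mP]; last first.
  by exists m => x; exact: (mP m (leqnn m) x).
have [m mP] := nbhs_agreeP (@homeo_continuous _ g x _ (nbhs_agree n (g x))).
exists ([set y | agree m x y], [set i | (m <= i)%N]) => //=.
  by split; [exact: nbhs_agree | exists m].
move=> [y i] /= [xy mi] z yz.
apply: (agree_trans (agree_sym (mP _ xy))).
by apply: mP; apply: agree_trans xy _; exact: agree_le yz.
Qed.

(** * Homeomorphisms of the Cantor set and their supports *)

Lemma mul_homeoE (f g : G) x : (f * g)%g x = f (g x). Proof. by []. Qed.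

Lemma homeo_K (g : G) x : (g^-1)%g (g x) = x.
Proof. exact: homeo_funK. Qed.

Lemma homeo_VK (g : G) x : g ((g^-1)%g x) = x.
Proof. exact: homeo_invK. Qed.

Lemma homeo_inj (g : G) : injective g.
Proof. exact: can_inj (@homeo_K g). Qed.

Lemma homeo_ext (f g : G) : (forall x, f x = g x) -> f = g.
Proof. by move=> fg; exact/homeo_eq/funext. Qed.

Lemma mk_homeo (f f' : X -> X) : cont f -> cont f' -> cancel f f' ->
  cancel f' f -> exists g : G, (forall x, g x = f x) /\ (forall x, (g^-1)%g x = f' x).
Proof.
move=> cf cf' fK f'K.
by exists (Homeo (cont_continuous cf) (cont_continuous cf') fK f'K).
Qed.

Definition V (n : nat) : set G := [set g | forall x, agree n (g x) x].

Lemma V1 n : V n 1%g. Proof. by []. Qed.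

Lemma VM n f g : V n f -> V n g -> V n (f * g)%g.
Proof. by move=> Vf Vg x; apply: agree_trans (Vf _) (Vg _). Qed.

Lemma VV n g : V n g -> V n (g^-1)%g.
Proof. by move=> Vg x; apply/agree_sym; have := Vg (g^-1 x)%g; rewrite homeo_VK. Qed.

Lemma V_le m n g : (m <= n)%N -> V n g -> V m g.
Proof. by move=> mn Vg x; exact: agree_le (Vg x). Qed.

Lemma V_conj (g : G) n : exists m, forall v, V m v -> V n (g * v * g^-1)%g.
Proof.
have [m mP] := homeo_unif g n; exists m => v Vv x.
by have := mP _ _ (Vv (g^-1 x)%g); rewrite homeo_VK.
Qed.

Lemma nbhs_V (g : G) n : nbhs g [set f : G | forall x, agree n (f x) (g x)].
Proof.
have : nbhs (homeo_fun g : {uniform X -> X})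
    [set f : {uniform X -> X} | forall x, agree n (f x) (g x)].
  apply/uniform_nbhs; exists [set xy | agree n xy.1 xy.2]; split.
    exact: entourage_agree.
  by move=> h /= gh x; apply/agree_sym/gh.
by move/(@initial_continuous G {uniform X -> X} (@homeo_fun X) g).
Qed.

Lemma open_subgroup (K : set G) n : (forall f g, K f -> K g -> K (f * g)%g) ->
  V n `<=` K -> open K.
Proof.
move=> KM VK; rewrite openE => g Kg; apply: filterS (nbhs_V g n) => f fg.
rewrite /= -[f](mulgVK g); apply: KM => //; apply: VK => x.
by have := fg (g^-1 x)%g; rewrite homeo_VK.
Qed.

(** The inverses have to converge uniformly as well, so that the two limits are continuous and
    inverse to each other. *)
Lemma homeo_lim (v : nat -> G) :
    (forall j x, agree j (v j.+1 x) (v j x)) ->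
    (forall j x, agree j ((v j.+1)^-1%g x) ((v j)^-1%g x)) ->
  exists g : G, (forall j x, agree j (g x) (v j x)) /\
    (forall j x, agree j (g^-1%g x) ((v j)^-1%g x)).
Proof.
have limP (w : nat -> G) : (forall j x, agree j (w j.+1 x) (w j x)) ->
    exists f, cont f /\ forall j x, agree j (f x) (w j x).
  move=> wP; have wle j k x : (j <= k)%N -> agree j (w k x) (w j x).
    move=> /subnKC <-; elim: (k - j)%N => [|d IH]; rewrite ?addn0 ?addnS //.
    by apply: agree_trans IH; apply: agree_le (wP _ _); exact: leq_addr.
  pose f x : X := fun i => w i.+1 x i.
  have fw j x : agree j (f x) (w j x).
    by move=> i ij; rewrite (wle i.+1 j x ij).
  exists f; split=> // x n; have [m mP] := homeo_unif (w n) n.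
  exists m => y /mP xy; apply: agree_trans (fw n x) _.
  exact: agree_trans xy (agree_sym (fw n y)).
move=> /limP[f [cf fv]] /limP[f' [cf' f'v]].
have K1 : cancel f f'.
  move=> x; apply/agree_eq => n; have [m mP] := cf' (f x) n.
  pose k := maxn m n.
  apply: agree_trans (mP (v k x) _) _.
    by apply: agree_le (fv k x); exact: leq_maxl.
  rewrite -{2}(homeo_K (v k) x).
  by apply: agree_le (f'v k (v k x)); exact: leq_maxr.
have K2 : cancel f' f.
  move=> x; apply/agree_eq => n; have [m mP] := cf (f' x) n.
  pose k := maxn m n.
  apply: agree_trans (mP ((v k)^-1%g x) _) _.
    by apply: agree_le (f'v k x); exact: leq_maxl.
  rewrite -{2}(homeo_VK (v k) x).
  by apply: agree_le (fv k ((v k)^-1%g x)); exact: leq_maxr.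
have [g [gf gf']] := mk_homeo cf cf' K1 K2.
by exists g; split=> j x; rewrite ?gf ?gf'.
Qed.

Definition supp (g : G) (A : set X) := forall x, ~ A x -> g x = x.

Lemma suppV g A : supp g A -> supp g^-1%g A.
Proof. by move=> gA x /gA gx; rewrite -{1}gx homeo_K. Qed.

Lemma supp_sub g A B : A `<=` B -> supp g A -> supp g B.
Proof. by move=> AB gA x Bx; apply: gA => /AB. Qed.

Lemma supp_stable g A x : supp g A -> A x -> A (g x).
Proof.
move=> gA Ax; apply: contrapT => nA.
by have /homeo_inj gx := gA _ nA; apply: nA; rewrite gx.
Qed.

Lemma supp_conj (g h : G) A : supp h A ->
  supp (g * h * g^-1)%g [set x | A (g^-1%g x)].
Proof. by move=> hA x nA; rewrite !mul_homeoE hA // homeo_VK. Qed.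

Lemma disjoint_commute (f g : G) A B : supp f A -> supp g B ->
  (forall x, A x -> ~ B x) -> (f * g = g * f)%g.
Proof.
move=> fA gB AB; apply: homeo_ext => x; rewrite !mul_homeoE.
have [Ax|nAx] := pselect (A x).
  have nBx := AB _ Ax; rewrite (gB x nBx) gB //.
  by apply: AB; exact: supp_stable.
rewrite (fA x nAx); have [Bx|nBx] := pselect (B x); last by rewrite gB // fA.
by rewrite fA // => /AB; apply; exact: supp_stable.
Qed.

(** The partial products of the [h j] converge: the factor [h j] changes no bit below [j] and, the
    supports being disjoint, leaves the earlier pieces alone. *)
Lemma homeo_glue (A : nat -> set X) (h : nat -> G) :
    (forall i j x, A i x -> A j x -> i = j) ->
    (forall j, supp (h j) (A j)) -> (forall j, V j (h j)) ->
  exists f : G, (forall j x, A j x -> f x = h j x) /\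
    (forall x, (forall j, ~ A j x) -> f x = x).
Proof.
move=> Adisj hA hV.
pose F := fix F j : G := if j is k.+1 then (F k * h k)%g else 1%g.
have FS j : F j.+1 = (F j * h j)%g by [].
have FA j x : (forall i, (i < j)%N -> ~ A i x) -> F j x = x.
  elim: j => // j IH nA; rewrite FS mul_homeoE (hA j x (nA _ (ltnSn _))).
  by apply: IH => i ij; apply: nA; exact: ltnW.
have FE i x k : A i x -> F (i.+1 + k)%N x = h i x.
  move=> Aix; elim: k => [|k IH].
    rewrite addn0 FS mul_homeoE FA // => l li All.
    have := Adisj _ _ _ All (supp_stable (hA i) Aix).
    by move=> E; rewrite E ltnn in li.
  rewrite addnS FS mul_homeoE (hA _ x) //.
  by move=> /(Adisj _ _ _ Aix)/eqP; rewrite ltn_eqF // addSn ltnS leq_addr.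
have [j x|j x|f [fF _]] := @homeo_lim F.
- rewrite FS mul_homeoE; have [Ajx|nA] := pselect (A j x); last first.
    by rewrite (hA j x nA).
  rewrite !FA; first exact: hV.
    by move=> i ij /Adisj-/(_ _ Ajx) E; rewrite E ltnn in ij.
  move=> i ij /Adisj-/(_ _ (supp_stable (hA j) Ajx)) E.
  by rewrite E ltnn in ij.
- by rewrite FS invgM mul_homeoE; exact: (VV (hV j)).
exists f; split=> [j x Ajx|x nA]; apply: agree_eq => n.
  rewrite -(FE j x n Ajx); apply: agree_le (fF (j.+1 + n)%N x).
  exact: leq_addl.
by rewrite -{2}(FA n x _).
Qed.

(** * Clopen sets *)

Definition det (N : nat) (A : set X) := forall x y, agree N x y -> A x -> A y.

Lemma det_le m n A : (m <= n)%N -> det m A -> det n A.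
Proof. by move=> mn dA x y xy; apply: dA; exact: agree_le xy. Qed.

Lemma detC n A : det n A -> det n (~` A).
Proof. by move=> dA x y /agree_sym xy nA Ay; apply: nA; exact: dA Ay. Qed.

Lemma detI n A B : det n A -> det n B -> det n (A `&` B).
Proof. by move=> dA dB x y xy [Ax Bx]; split; [exact: dA Ax|exact: dB Bx]. Qed.

Lemma detU n A B : det n A -> det n B -> det n (A `|` B).
Proof.
by move=> dA dB x y xy [Ax|Bx]; [left; exact: dA Ax|right; exact: dB Bx].
Qed.

Lemma det_bit n i b : (i < n)%N -> det n [set x | x i = b].
Proof. by move=> ni x y /(_ i ni) /= <-. Qed.

Definition scons (b : bool) (y : X) : X := fun i => if i is j.+1 then y j else b.

Definition stl (x : X) : X := fun i => x i.+1.

Lemma scons_stl x : scons (x 0) (stl x) = x.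
Proof. by apply/funext => -[]. Qed.

Lemma stl_scons b x : stl (scons b x) = x. Proof. by []. Qed.

Lemma agree_scons n b x y : agree n x y -> agree n.+1 (scons b x) (scons b y).
Proof. by move=> xy [|i] // /xy. Qed.

Lemma agree_stl n x y : agree n.+1 x y -> agree n (stl x) (stl y).
Proof. by move=> xy i ni; exact: (xy i.+1). Qed.

Lemma neq_negb (a b : bool) : a <> b -> a = ~~ b.
Proof. by case: a; case: b. Qed.

(** Induction on the level, splitting by the first bit. If both halves of [A] are nonempty, their
    charts are put side by side; if only one is, its chart prefixed by that bit covers [A]. *)
Lemma cantor_chart N (A : set X) : det N A -> (exists x, A x) ->
  exists f f' : X -> X, [/\ cont f, cont f', (forall x, A (f x)),
    cancel f f' & forall x, A x -> f (f' x) = x].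
Proof.
elim: N A => [|N IHN] A dA [a Aa].
  exists id, id; split=> //; try by move=> x n; exists n.
  by move=> x; apply: dA Aa => i.
pose B b : set X := [set y | A (scons b y)].
have dB b : det N (B b).
  by move=> x y xy; apply: dA; exact: agree_scons.
have one b : (exists x, B b x) -> (forall x, ~ B (~~ b) x) ->
    exists f f' : X -> X, [/\ cont f, cont f', (forall x, A (f x)),
    cancel f f' & forall x, A x -> f (f' x) = x].
  move=> /(IHN _ (dB b))[f [f' [cf cf' fB fK f'K]]] nB.
  exists (fun x => scons b (f x)), (fun x => f' (stl x)); split.
  - move=> x n; have [m mP] := cf x n; exists m => y /mP.
    by move=> xy; apply: (@agree_le _ n.+1) => //; exact: agree_scons.
  - move=> x n; have [m mP] := cf' (stl x) n; exists m.+1 => y /agree_stl.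
    exact: mP.
  - by move=> x; exact: fB.
  - by move=> x; rewrite stl_scons fK.
  - move=> x Ax; have xb : x 0 = b.
      apply: contrapT => /neq_negb xb; apply: (nB (stl x)); rewrite /B /=.
      by rewrite -xb scons_stl.
    rewrite f'K; first by rewrite -xb scons_stl.
    by rewrite /B /= -xb scons_stl.
have [Bt|Bt] := pselect (exists x, B true x); last first.
  apply: (one false) => /=; last by move=> x Bx; apply: Bt; exists x.
  exists (stl a); rewrite /B /=; suff <- : a 0 = false by rewrite scons_stl.
  apply: contrapT => /neq_negb /= a0; apply: Bt.
  by exists (stl a); rewrite /B /= -a0 scons_stl.
have [Bf|Bf] := pselect (exists x, B false x); last first.
  by apply: (one true) => //= x Bx; apply: Bf; exists x.
have [ft [ft' [cft cft' ftB ftK ft'K]]] := IHN _ (dB true) Bt.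
have [ff [ff' [cff cff' ffB ffK ff'K]]] := IHN _ (dB false) Bf.
exists (fun x => scons (x 0) ((if x 0 then ft else ff) (stl x))).
exists (fun x => scons (x 0) ((if x 0 then ft' else ff') (stl x))).
have cs (h k : X -> X) : cont h -> cont k ->
    cont (fun x => scons (x 0) ((if x 0 then h else k) (stl x))).
  move=> ch ck x n; have [m mP] := ch (stl x) n; have [p pP] := ck (stl x) n.
  exists (maxn m p).+1 => y xy; have <- := xy 0 (ltn0Sn _).
  apply: (@agree_le _ n.+1) => //; apply: agree_scons.
  have {}xy := agree_stl xy.
  case: (x 0); [apply: mP|apply: pP]; apply: (agree_le _ xy).
    exact: leq_maxl.
  exact: leq_maxr.
split; [exact: cs|exact: cs| | |].
- by move=> x; case: (x 0); [exact: ftB|exact: ffB].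
- move=> x; rewrite -[RHS]scons_stl stl_scons /=.
  by case: (x 0); rewrite ?ftK ?ffK.
- move=> x Ax; rewrite -[RHS]scons_stl stl_scons /=.
  by have := Ax; rewrite -{1}(scons_stl x); case: (x 0) => Bx;
    rewrite ?ft'K ?ff'K.
Qed.

(** Homogeneity of the Cantor set: the colour classes of [P] and [Q] are nonempty clopens, hence
    Cantor sets, and [u] carries each class of [P] onto the class of [Q] of the same colour through
    their charts. *)
Lemma recolor (T : choiceType) N (P Q : X -> T) :
    (forall x y, agree N x y -> P x = P y) ->
    (forall x y, agree N x y -> Q x = Q y) ->
    (forall x, exists y, Q y = P x) -> (forall x, exists y, P y = Q x) ->
  exists u : G, forall x, Q (u x) = P x.
Proof.
have chart (R : X -> T) : (forall x y, agree N x y -> R x = R y) ->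
    exists p : T -> (X -> X) * (X -> X), forall c, (exists y, R y = c) ->
    [/\ cont (p c).1, cont (p c).2, (forall x, R ((p c).1 x) = c),
      cancel (p c).1 (p c).2 & forall x, R x = c -> (p c).1 ((p c).2 x) = x].
  move=> RN; have /choice[p pP] : forall c, exists p : (X -> X) * (X -> X),
    (exists y, R y = c) -> [/\ cont p.1, cont p.2, (forall x, R (p.1 x) = c),
      cancel p.1 p.2 & forall x, R x = c -> p.1 (p.2 x) = x]; last by exists p.
  move=> c.
  have [cR|cR] := pselect (exists y, R y = c); last by exists (id, id) => /cR.
  have [|f [f' H]] := @cantor_chart N [set x | R x = c] _ cR.
    by move=> x y /RN /= <-.
  by exists (f, f').
move=> PN QN PQ QP.
have [p pP] := chart P PN; have [q qP] := chart Q QN.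
have tr (R S : X -> T) r s :
    (forall x y, agree N x y -> R x = R y) ->
    (forall x, exists y, S y = R x) ->
    (forall c, (exists y, R y = c) ->
    [/\ cont (r c).1, cont (r c).2, (forall x, R ((r c).1 x) = c),
      cancel (r c).1 (r c).2 & forall x, R x = c -> (r c).1 ((r c).2 x) = x]) ->
    (forall c, (exists y, S y = c) ->
    [/\ cont (s c).1, cont (s c).2, (forall x, S ((s c).1 x) = c),
      cancel (s c).1 (s c).2 & forall x, S x = c -> (s c).1 ((s c).2 x) = x]) ->
  [/\ cont (fun x => (s (R x)).1 ((r (R x)).2 x)),
      forall x, S ((s (R x)).1 ((r (R x)).2 x)) = R x &
      forall x, (r (R x)).1 ((s (R x)).2 ((s (R x)).1 ((r (R x)).2 x))) = x].
  move=> RN RS rP sP.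
  have rP' x := rP (R x) (ex_intro _ x erefl); have sP' x := sP (R x) (RS x).
  split=> [x n|x|x].
  - have [_ cr _ _ _] := rP' x; have [cs _ _ _ _] := sP' x.
    have [m mP] := cs ((r (R x)).2 x) n; have [k kP] := cr x m.
    exists (maxn N k) => y xy.
    rewrite -(RN x y); last by apply: agree_le xy; exact: leq_maxl.
    by apply/mP/kP; apply: agree_le xy; exact: leq_maxr.
  - by have [_ _ H _ _] := sP' x.
  - by have [_ _ _ H _] := sP' x; have [_ _ _ _ H'] := rP' x; rewrite H H'.
have [cu uR uK] := tr P Q p q PN PQ pP qP.
have [cu' u'R u'K] := tr Q P q p QN QP qP pP.
have [|x|u [uE _]] := mk_homeo cu cu'.
- by move=> x; rewrite uR uK.
- by rewrite u'R u'K.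
- by exists u => x; rewrite uE uR.
Qed.

(** * Commutators and full sets *)

(** An element of [V M] preserves every clopen of level [M], so replacing it by the identity off [A]
    keeps it a homeomorphism. *)
Lemma restrict_homeo M A g : det M A -> V M g ->
  exists g', [/\ V M g', supp g' A & forall x, A x -> g' x = g x].
Proof.
move=> dA Vg.
have ck (h : G) : V M h -> cont (fun x => if `[< A x >] then h x else x).
  move=> Vh x n; have [m mP] := homeo_unif h n; exists (maxn (maxn m n) M).
  move=> y xy.
  have xyM : agree M x y by apply: agree_le xy; rewrite leq_max leqnn orbT.
  have -> : `[< A y >] = `[< A x >].
    by apply: asbool_equiv_eq; split; apply: dA => //; exact: agree_sym.
  case: asbool; [apply: mP|]; apply: agree_le xy;
    by rewrite !leq_max leqnn ?orbT.
have kK (h k : G) : V M h -> (forall x, k (h x) = x) ->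
    cancel (fun x => if `[< A x >] then h x else x)
           (fun x => if `[< A x >] then k x else x).
  move=> Vh kh x; have [Ax|nAx] := asboolP (A x).
    rewrite asboolT ?kh //; apply: dA Ax; exact/agree_sym/Vh.
  by rewrite asboolF.
have [g' [g'E _]] := mk_homeo (ck g Vg) (ck g^-1%g (VV Vg))
  (kK g g^-1%g Vg (homeo_K g)) (kK g^-1%g g (VV Vg) (homeo_VK g)).
exists g'; split.
- by move=> x; rewrite g'E; case: asboolP => // _; exact: Vg.
- by move=> x nAx; rewrite g'E asboolF.
- by move=> x Ax; rewrite g'E asboolT.
Qed.

Definition shift (N : nat) (x : X) : X := fun i => x (N + i)%N.

Definition splice (N : nat) (x y : X) : X :=
  fun i => if (i < N)%N then x i else y (i - N)%N.

Lemma splice_agree N x y : agree N (splice N x y) x.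
Proof. by move=> i iN; rewrite /splice iN. Qed.

Lemma shift_splice N x y : shift N (splice N x y) = y.
Proof.
by apply/funext => i; rewrite /shift /splice ltnNge leq_addr /= addKn.
Qed.

Lemma splice_shift N x : splice N x (shift N x) = x.
Proof.
apply/funext => i; rewrite /splice /shift; case: ltnP => // Ni.
by rewrite subnKC.
Qed.

Lemma splice_splice N x y z : splice N (splice N x y) z = splice N x z.
Proof. by apply/funext => i; rewrite /splice; case: (i < N)%N. Qed.

Lemma lift_homeo N (f : G) : exists g, V N g /\
  forall x, g x = splice N x (f (shift N x)).
Proof.
have ck (h : G) : cont (fun x => splice N x (h (shift N x))).
  move=> x n; have [m mP] := homeo_unif h n.
  exists (N + maxn m n)%N => y xy i ni; rewrite /splice.
  case: ltnP => iN; first by apply: xy; rewrite ltn_addr.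
  apply: (mP _ _ _ _ (leq_ltn_trans (leq_subr _ _) ni)) => j jm.
  by apply: xy; rewrite ltn_add2l leq_max jm.
have kK (h k : G) : (forall x, k (h x) = x) ->
    cancel (fun x => splice N x (h (shift N x)))
           (fun x => splice N x (k (shift N x))).
  by move=> kh x; rewrite shift_splice kh splice_splice splice_shift.
have [g [gE _]] := mk_homeo (ck f) (ck f^-1%g)
  (kK f f^-1%g (homeo_K f)) (kK f^-1%g f (homeo_VK f)).
by exists g; split=> // x; rewrite gE; exact: splice_agree.
Qed.

(** The cylinders 10, 01, 001, 0001, and so on. Starting at 10 instead of 1 leaves the cylinder 11,
    which can be stretched over 1 to fill the vacated place. *)
Definition ladder (i : nat) (z : X) : Prop :=
  if i is k.+1 then (forall j, (j < k.+1)%N -> z j = false) /\ z k.+1 = true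
  else z 0 = true /\ z 1 = false.

Lemma ladder_inj i j z : ladder i z -> ladder j z -> i = j.
Proof.
case: i j => [|i] [|j] //=.
- by move=> [z0 _] [/(_ 0 erefl)]; rewrite z0.
- by move=> [/(_ 0 erefl) z0 _] []; rewrite z0.
move=> [iF iT] [jF jT]; have [ij|ij|->//] := ltngtP i j.
  by have := jF i.+1 ij; rewrite iT.
by have := iF j.+1 ij; rewrite jT.
Qed.

(* The generator x_0 of Thompson's group F: it moves the cylinder 10 to 01, and
   then along the cylinders 0^i 1, which shrink to a point. *)
Lemma thompson : exists s : G,
  (forall i z, ladder i z -> ladder i.+1 (s z)) /\
  (forall i z, ladder i.+1 z -> ladder i (s^-1%g z)).
Proof.
pose f (x : X) : X := if x 0 then
    (if x 1 then stl x else scons false (scons true (stl (stl x))))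
  else scons false x.
pose f' (x : X) : X := if x 0 then scons true x else
    (if x 1 then scons true (scons false (stl (stl x))) else stl x).
have cf : cont f.
  move=> x n; exists n.+2 => y xy; rewrite /f -(xy 0 erefl) -(xy 1 erefl).
  have xy1 : agree n (stl x) (stl y).
    by apply: agree_stl; apply: agree_le xy.
  have xy2 : agree n (stl (stl x)) (stl (stl y)) by do 2 apply: agree_stl.
  have xy0 : agree n x y by apply: agree_le xy; rewrite -addn2 leq_addr.
  by case: (x 0); [case: (x 1) => //|]; apply: (@agree_le _ n.+1) => //;
    apply: agree_scons => //; apply: (@agree_le _ n.+1) => //;
    apply: agree_scons.
have cf' : cont f'.
  move=> x n; exists n.+2 => y xy; rewrite /f' -(xy 0 erefl) -(xy 1 erefl).
  have xy1 : agree n (stl x) (stl y).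
    by apply: agree_stl; apply: agree_le xy.
  have xy2 : agree n (stl (stl x)) (stl (stl y)) by do 2 apply: agree_stl.
  have xy0 : agree n x y by apply: agree_le xy; rewrite -addn2 leq_addr.
  by case: (x 0); [|case: (x 1) => //]; apply: (@agree_le _ n.+1) => //;
    apply: agree_scons => //; apply: (@agree_le _ n.+1) => //;
    apply: agree_scons.
have ff' : cancel f f'.
  move=> x; apply/funext => i; rewrite /f /f' /stl.
  by case x0: (x 0); case x1: (x 1); case: i => [|[|i]] //=; rewrite ?x0 ?x1.
have f'f : cancel f' f.
  move=> x; apply/funext => i; rewrite /f /f' /stl.
  by case x0: (x 0); case x1: (x 1); case: i => [|[|i]] //=; rewrite ?x0 ?x1.
have [s [sE s'E]] := mk_homeo cf cf' ff' f'f.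
exists s; split=> [[|i] z|[|i] z]; rewrite ?sE ?s'E /f /f' /=.
- by move=> [-> ->]; split=> // -[].
- move=> [zF zT]; rewrite zF //=; split=> // -[|j] //=.
  by rewrite ltnS; exact: zF.
- by move=> [/(_ 0 erefl) -> ->].
- move=> [zF zT]; rewrite !zF //=; split=> // j ji.
  by rewrite /stl; exact: zF.
Qed.

(** Infinite repetition: let [s] be [thompson] acting on the tails after level [N] inside [B], and
    [f] the product of all [s^i * h * s^-i], which have disjoint supports. Then
    [f = h * (s * f * s^-1)], so [h] is the commutator of [f] and [s]. *)
Lemma commutator_of_local N B h : det N B -> V N h ->
    supp h (B `&` [set x | x N = true /\ x N.+1 = false]) ->
  exists a b : G, [/\ V N a, V N b, supp a B, supp b B &
    h = (a * b / (b * a))%g].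
Proof.
move=> dB Vh hD; have [s0 [s0A s0B]] := thompson.
have [s1 [Vs1 s1E]] := lift_homeo N s0.
have [s [Vs sB sE]] := restrict_homeo dB Vs1.
have s1VE x : s1^-1%g x = splice N x (s0^-1%g (shift N x)).
  apply: (@homeo_inj s1); rewrite homeo_VK s1E shift_splice homeo_VK.
  by rewrite splice_splice splice_shift.
have sVE x : B x -> s^-1%g x = s1^-1%g x.
  move=> Bx; apply: (@homeo_inj s); rewrite homeo_VK sE ?homeo_VK //.
  by apply: dB Bx; exact/agree_sym/VV.
pose A i : set X := [set x | B x /\ ladder i (shift N x)].
have AS i x : A i x -> A i.+1 (s x).
  move=> [Bx lx]; split; first by apply: dB Bx; exact/agree_sym/Vs.
  by rewrite sE // s1E shift_splice; exact: s0A.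
have AV i x : A i.+1 x -> A i (s^-1%g x).
  move=> [Bx lx]; split; first by apply: dB Bx; exact/agree_sym/VV.
  by rewrite sVE // s1VE shift_splice; exact: s0B.
have Adisj i j x : A i x -> A j x -> i = j.
  by move=> [_ lx] [_]; exact: ladder_inj.
pose hh := fix hh i : G := if i is k.+1 then (s * hh k * s^-1)%g else h.
have hhS i : hh i.+1 = (s * hh i * s^-1)%g by [].
have hA i : supp (hh i) (A i).
  elim: i => [|i IH].
    apply: (supp_sub _ hD) => x [Bx] /= [x0 x1].
    by split; rewrite //= /shift addn0 addn1.
  rewrite hhS; apply: (supp_sub _ (supp_conj (g := s) IH)) => x /= /AS.
  by rewrite homeo_VK.
have hhN i : V N (hh i).
  by elim: i => [|i IH] //; rewrite hhS; apply: VM; [exact: VM|exact: VV].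
have hhV i : V i (hh i).
  move=> x; have [Ax|nAx] := pselect (A i x); last by rewrite (hA i x nAx).
  have [_ lhx] := supp_stable (hA i) Ax; move: Ax => [_ lx] j ji.
  have [jN|Nj] := ltnP j N; first exact: (hhN i x j jN).
  case: i lhx lx ji => [|i] // [hF _] [xF _] ji.
  have jNi : (j - N < i.+1)%N by exact: leq_ltn_trans (leq_subr _ _) ji.
  have := hF _ jNi; have := xF _ jNi.
  by rewrite /shift subnKC // => -> ->.
have [f [fA fid]] := homeo_glue Adisj hA hhV.
exists f, s; split=> //.
- move=> x; have [[i Ax]|nA] := pselect (exists i, A i x).
    by rewrite (fA i x Ax); exact: hhN.
  by rewrite fid // => i Ax; apply: nA; exists i.
- by move=> x nBx; apply: fid => i [].
suff E : f = (h * (s * f * s^-1))%g.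
  have -> : h = (f / (s * f * s^-1))%g by rewrite {1}E mulgK.
  by rewrite !invgM invgK !mulgA.
apply: homeo_ext => x; rewrite !mul_homeoE.
have hid i : A i.+1 x -> h x = x.
  by move=> Ax; apply: (hA 0) => /Adisj-/(_ _ Ax).
have [[[|i] Ax]|nA] := pselect (exists i, A i x).
- rewrite (fid (s^-1%g x)) ?homeo_VK ?(fA _ _ Ax) // => i /AS.
  by rewrite homeo_VK => /Adisj-/(_ _ Ax).
- rewrite (fA _ _ Ax) (fA _ _ (AV _ _ Ax)) hhS !mul_homeoE.
  apply/esym/(hA 0) => H; suff: 0 = i.+1 by [].
  apply: Adisj H _; have := supp_stable (hA i.+1) Ax.
  by rewrite hhS !mul_homeoE.
rewrite fid; last by move=> i Ax; apply: nA; exists i.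
rewrite fid; last by move=> i /AS; rewrite homeo_VK => Ax; apply: nA; exists i.+1.
by rewrite homeo_VK; apply/esym/(hA 0) => Ax; apply: nA; exists 0.
Qed.

Definition hits (n : nat) (A : set X) := forall x, exists2 y, agree n x y & A y.

Lemma hits_sub n A B : A `<=` B -> hits n A -> hits n B.
Proof. by move=> AB hA x; have [y xy /AB] := hA x; exists y. Qed.

Definition full (n : nat) (C : set X) (S : set G) :=
  forall h, V n h -> supp h C -> exists2 g, S g & forall x, C x -> g x = h x.

Definition set_bit (i : nat) (b : bool) (x : X) : X :=
  fun j => if j == i then b else x j.

Lemma set_bit_agree n i b x : (n <= i)%N -> agree n x (set_bit i b x).
Proof. by move=> ni j jn; rewrite /set_bit ltn_eqF // (leq_trans jn). Qed.

Lemma set_bit_eq i b x : set_bit i b x i = b.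
Proof. by rewrite /set_bit eqxx. Qed.

(** Colour a point by its cylinder of level [n] and by membership in the set; the same colours occur
    for both sets, so [recolor] applies. *)
Lemma move_set n N A A' : (n <= N)%N -> det N A -> det N A' ->
    hits n A -> hits n (~` A) -> hits n A' -> hits n (~` A') ->
  exists2 u, V n u & forall x, A' (u x) <-> A x.
Proof.
move=> nN dA dA' hA hnA hA' hnA'.
pose P (A : set X) x := (mkseq x n, `[< A x >]).
have PN B : det N B -> forall x y, agree N x y -> P B x = P B y.
  move=> dB x y xy; congr pair; first exact/agree_mkseq/(agree_le nN).
  by apply: asbool_equiv_eq; split; apply: dB => //; exact: agree_sym.
have PP B B' : hits n B' -> hits n (~` B') -> forall x, exists y, P B' y = P B x.
  move=> hB hnB x; have [Bx|nBx] := pselect (B x).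
    have [y xy By] := hB x; exists y.
    by rewrite /P !asboolT //; congr pair; exact/agree_mkseq/agree_sym.
  have [y xy By] := hnB x; exists y.
  by rewrite /P !asboolF //; congr pair; exact/agree_mkseq/agree_sym.
have [u uP] := recolor (PN _ dA) (PN _ dA') (PP _ _ hA' hnA') (PP _ _ hA hnA).
exists u => x; have [E1 E2] := uP x; first exact/agree_mkseq.
split; first by move=> A'u; apply/asboolP; rewrite -E2; exact/asboolP.
by move=> Ax; apply/asboolP; rewrite E2; exact/asboolP.
Qed.

(* Modulo elements with disjoint supports [g] is [a] and [g'] is [b]. *)
Lemma commutator_transfer (C C' : set X) (a b g g' : G) :
    (forall x, C x \/ C' x) -> supp a (C `&` C') -> supp b (C `&` C') ->
    (forall x, C x -> g x = a x) -> (forall x, C' x -> g' x = b x) ->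
  (a * b / (b * a) = g * g' / (g' * g))%g.
Proof.
move=> CC' aC bC ga g'b.
pose l := (a^-1 * g)%g; pose l' := (b^-1 * g')%g.
have lC : supp l (~` C).
  by move=> x /contrapT Cx; rewrite mul_homeoE ga // homeo_K.
have lC' : supp l' (~` C').
  by move=> x /contrapT Cx; rewrite mul_homeoE g'b // homeo_K.
have lb : (l * b = b * l)%g.
  by apply: disjoint_commute lC bC _ => x nC [].
have l'a : (l' * a = a * l')%g.
  by apply: disjoint_commute lC' aC _ => x nC [].
have ll' : (l * l' = l' * l)%g.
  by apply: disjoint_commute lC lC' _ => x nC nC'; case: (CC' x).
have -> : g = (a * l)%g by rewrite mulgA mulgV mul1g.
have -> : g' = (b * l')%g by rewrite mulgA mulgV mul1g.
have -> : (a * l * (b * l') = a * b * (l * l'))%g.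
  by rewrite mulgA -(mulgA a) lb !mulgA.
have -> : (b * l' * (a * l) = b * a * (l * l'))%g.
  by rewrite mulgA -(mulgA b) l'a ll' !mulgA.
by rewrite -[RHS]mulgA (invgM (b * a)%g) (mulgA (l * l')%g) mulgV mul1g.
Qed.

Lemma set_exp1 (S : set G) g : S g -> set_exp S 1 g.
Proof. by move=> Sg; exists (fun=> g) => //; rewrite big_ord1. Qed.

Lemma set_expM (S : set G) p q f g : set_exp S p f -> set_exp S q g ->
  set_exp S (p + q) (f * g)%g.
Proof.
move=> [u uS <-] [v vS <-].
exists (fun i => match fintype.split i with inl j => u j | inr j => v j end).
  by move=> i /=; case: fintype.split => j; [exact: uS|exact: vS].
rewrite big_split_ord; congr (_ * _)%g; apply: eq_bigr => i _ /=.
  by have := unsplitK (inl i : 'I_p + 'I_q)%type; rewrite /unsplit => ->.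
by have := unsplitK (inr i : 'I_p + 'I_q)%type; rewrite /unsplit => ->.
Qed.

(* If [S] contains every homeomorphism of [C] up to what happens outside [C],
   move [C] by an element of [S] to a set that covers the complement of [C]:
   commutators of the two families then act on the overlap only, and every
   homeomorphism of a small piece of the overlap is a commutator. *)
Lemma full_open n N C : det N C -> hits n C -> hits n (~` C) ->
  exists phi psi m M, [/\ V n phi, V n psi & forall S : set G,
    (forall g, S g -> S g^-1%g) -> full n C S ->
    (exists2 g, S g & V m (phi^-1 * g)%g) ->
    (exists2 g, S g & V m (psi^-1 * g)%g) -> V M `<=` set_exp S 18].
Proof.
wlog nN : N / (n <= N)%N.
  move=> H dC; apply: (H (maxn n N)); first exact: leq_maxl.
  by apply: det_le dC; exact: leq_maxr.
(* Bit [N] halves [C], so that [C] and [C'] cover the space with overlap [B]; the bits [N1] and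
   [N1.+1] cut out of [B] the piece [D] to which [commutator_of_local] applies. *)
move=> dC hC hnC; pose N1 := N.+1; pose N2 := N.+3.
have nN1 : (n <= N1)%N by exact: leqW.
have nN2 : (n <= N2)%N by do 2 apply: leqW.
pose B := C `&` [set x | x N = false].
pose C' := ~` C `|` B.
pose D := B `&` [set x | x N1 = true /\ x N1.+1 = false].
have dC1 : det N1 C by apply: det_le dC.
have dB : det N1 B by apply: detI dC1 _; exact: det_bit.
have dC' : det N1 C' by apply: detU dB; exact: detC.
have dD : det N2 D.
  apply: detI; first by apply: det_le dB; exact: leqW.
  by apply: (@detI _ [set x | x N1 = true] [set x | x N1.+1 = false]);
    exact: det_bit.
have hC' : hits n C' by apply: hits_sub hnC => x; left.
have hnC' : hits n (~` C').
  move=> x; have [y xy Cy] := hC x; exists (set_bit N true y).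
    by apply: agree_trans xy _; exact: set_bit_agree.
  have Cy' : C (set_bit N true y) by apply: dC Cy; exact: set_bit_agree.
  by move=> [//|[_ /=]]; rewrite set_bit_eq.
have hD : hits n D.
  move=> x; have [y xy Cy] := hC x.
  pose z := set_bit N1.+1 false (set_bit N1 true (set_bit N false y)).
  have yz : agree N y z.
    by do 3 (apply: agree_trans (set_bit_agree _ _ _); last
      by rewrite /N1 ?leqnSn // ltnW).
  exists z; first exact: agree_trans xy (agree_le nN yz).
  have N01 := ltn_eqF (ltnSn N); have N12 := ltn_eqF (ltnSn N1).
  have N02 : (N == N1.+1) = false by rewrite ltn_eqF // ltnS.
  split; first by split; [exact: dC Cy|rewrite /z /set_bit /= N02 N01 eqxx].
  by rewrite /z /set_bit /= N12 !eqxx.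
have hnD : hits n (~` D).
  move=> x; exists (set_bit N1 false x); first exact: set_bit_agree.
  by move=> [_] /= []; rewrite set_bit_eq.
have [phi Vphi phiC] := move_set nN1 dC1 dC' hC hnC hC' hnC'.
have [psi Vpsi psiD] : exists2 u, V n u & forall x, (~` D) (u x) <-> D x.
  by apply: (move_set nN2) => //; [exact: detC|rewrite setCK].
have [M0 M0P] := V_conj psi^-1%g N2.
exists phi, psi, N2, (maxn M0 N2); split=> // S SV SC [g1 Sg1 Vg1] [g2 Sg2 Vg2].
have g1C x : C' (g1 x) <-> C x.
  rewrite -[g1](mulVKg phi) mul_homeoE phiC.
  have Vx : agree N ((phi^-1 * g1)%g x) x.
    by apply: agree_le (Vg1 x); rewrite /N2 -addn3 leq_addr.
  by split; apply: dC => //; exact: agree_sym.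
have g1n : V n g1.
  by rewrite -[g1](mulVKg phi); apply: VM => //; exact: V_le Vg1.
(* [h] is a commutator of some [a] and [b] supported in [B]; [s] imitates [a] on [C], and
   [g1 * s' * g1^-1] imitates [b] on [C']. This costs 1 + 3 + 1 + 3 factors. *)
have small h : V N1 h -> supp h D -> set_exp S 8 h.
  move=> Vh hD'; have [a [b [Va Vb aB bB ->]]] := commutator_of_local dB Vh hD'.
  have [s Ss sa] : exists2 s, S s & forall x, C x -> s x = a x.
    by apply: SC; [exact: V_le Va|apply: supp_sub aB => x []].
  have [s' Ss' sb] : exists2 s', S s' &
      forall x, C x -> s' x = (g1^-1 * b * g1)%g x.
    apply: SC.
      by do 2 apply: VM => //; [exact: VV|exact: V_le Vb].
    have := supp_conj (g := (g1^-1)%g) bB; rewrite invgK; apply: supp_sub => x /= Bx.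
    by apply/g1C; right.
  have sb' x : C' x -> (g1 * s' * g1^-1)%g x = b x.
    move=> Cx; rewrite !mul_homeoE sb; last first.
      by apply/g1C; rewrite homeo_VK.
    by rewrite !mul_homeoE !homeo_VK.
  rewrite (@commutator_transfer C C' a b s (g1 * s' * g1^-1)%g) //; first last.
  - by apply: supp_sub bB => x Bx; split; [case: Bx|right].
  - by apply: supp_sub aB => x Bx; split; [case: Bx|right].
  - by move=> x; have [Cx|Cx] := pselect (C x); [left|right; left].
  have E1 := @set_exp1 S.
  have SV1 g : S g -> set_exp S 1 g^-1%g by move=> /SV /E1.
  have gs t : set_exp S 1 t -> set_exp S 3 (g1 * t * g1^-1)%g.
    move=> St; apply: (@set_expM _ 2 1); last exact: SV1.
    by apply: (@set_expM _ 1 1) => //; exact: E1.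
  rewrite invgM mulgA -mulgA.
  apply: (@set_expM _ 4 4).
    by apply: (@set_expM _ 1 3); [exact: E1|apply: gs; exact: E1].
  apply: (@set_expM _ 1 3); first exact: SV1.
  by rewrite !invgM invgK mulgA; apply: gs; exact: SV1.
move=> g Vg; have dDM : det (maxn M0 N2) D by apply: det_le dD; exact: leq_maxr.
have [h [Vh hD' hE]] := restrict_homeo dDM Vg.
(* [g] is split into its part on [D] and a rest [k] off [D], which [g2] conjugates into [D]: 8 + (1
   + 8 + 1) factors. *)
have -> : g = (h * (h^-1 * g))%g by rewrite mulVKg.
apply: (@set_expM _ 8 10).
  apply: small hD'; apply: V_le Vh; apply: leq_trans (leq_maxr _ _).
  exact: leqW.
set k := (h^-1 * g)%g.
have Vk : V (maxn M0 N2) k by apply: VM => //; exact: VV.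
have kD : supp k (~` D).
  by move=> x /contrapT Dx; rewrite mul_homeoE -hE // homeo_K.
have -> : k = (g2 * (g2^-1 * k * g2) * g2^-1)%g by rewrite !mulgA mulgV mul1g mulgK.
apply: (@set_expM _ 9 1); last by apply: set_exp1; exact: SV.
apply: (@set_expM _ 1 8); first exact: set_exp1.
apply: small.
  rewrite -[g2](mulVKg psi); set v := (psi^-1 * g2)%g.
  have -> : ((psi * v)^-1 * k * (psi * v) = v^-1 * (psi^-1 * k * psi) * v)%g.
    by rewrite invgM !mulgA.
  have W : V N2 (psi^-1 * k * psi)%g.
    have := M0P k; rewrite invgK; apply; apply: V_le Vk; exact: leq_maxl.
  have : V N2 (v^-1 * (psi^-1 * k * psi) * v)%g.
    by do 2 apply: VM => //; exact: VV.
  by apply: V_le; rewrite ltnS leqW.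
have := supp_conj (g := (g2^-1)%g) kD; rewrite invgK; apply: supp_sub => x.
move=> H; apply: dD (Vg2 x) (iffLR (psiD _) _).
by rewrite -mul_homeoE mulVKg.
Qed.

(** * Fusion and Baire category *)

Definition is_subgp (R : set G) := [/\ R 1%g,
  forall f g, R f -> R g -> R (f * g)%g & forall g, R g -> R g^-1%g].

Definition seq_closed (R : set G) :=
  forall g, (forall m, exists2 r, R r & V m (r^-1 * g)%g) -> R g.

Lemma subgp_V m : is_subgp (V m).
Proof. by split; [exact: V1|exact: VM|exact: VV]. Qed.

Lemma seq_closed_V m : seq_closed (V m).
Proof.
by move=> g /(_ m)[r Vr Vg]; rewrite -[g](mulVKg r); exact: VM.
Qed.

(** The centres [v l] of the decreasing cosets [v l R l] converge: right factors from [R l] do not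
    change the first [l] bits of the values of [v l] nor, since they lie in [V l], those of the
    inverses. The limit stays in each coset by closedness. *)
Lemma fusion (v : nat -> G) (R : nat -> set G) :
    (forall l, is_subgp (R l)) -> (forall l, seq_closed (R l)) ->
    (forall l, R l.+1 `<=` R l) -> (forall l, R l ((v l)^-1 * v l.+1)%g) ->
    (forall l, R l `<=` V l) ->
    (forall l r x, R l r -> agree l (v l (r x)) (v l x)) ->
  exists g : G, forall l, R l ((v l)^-1 * g)%g.
Proof.
move=> Rg Rc Rdec vR RV Rv.
have [l x|l x|g [_ gV]] := @homeo_lim v.
- by rewrite -[v l.+1](mulVKg (v l)) mul_homeoE; exact: Rv.
- rewrite -[v l.+1](mulVKg (v l)) invgM mul_homeoE.
  by apply: RV; have [_ _ RI] := Rg l; exact: RI.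
have Rle l m : R (l + m)%N `<=` R l.
  by elim: m => [|m IH]; rewrite ?addn0 ?addnS // => r /Rdec /IH.
exists g => l; apply: Rc => m; exists ((v l)^-1 * v (l + m)%N)%g.
  elim: m => [|m IH]; first by rewrite addn0 mulVg; case: (Rg l).
  have -> : ((v l)^-1 * v (l + m.+1)%N)%g =
      ((v l)^-1 * v (l + m)%N * ((v (l + m)%N)^-1 * v (l + m).+1))%g.
    by rewrite mulgA mulgK addnS.
  by have [_ RM _] := Rg l; apply: RM => //; exact: (Rle l m).
rewrite invgM invgK -mulgA mulVKg => x; rewrite mul_homeoE.
apply: (@agree_le _ (l + m)); first exact: leq_addl.
by have := gV (l + m)%N (g x); rewrite homeo_K => /agree_sym.
Qed.

Lemma agree_modulus (v : G) n :
  exists m, forall r x, V m r -> agree n (v (r x)) (v x).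
Proof. by have [m mP] := homeo_unif v n; exists m => r x Vr; exact: mP. Qed.

(** The Baire category theorem: the hypothesis gives a dense open set inside each [E j], and
    [fusion] is applied to a decreasing sequence of basic sets [w V m]. *)
Lemma baire_homeo (E : nat -> set G) :
    (forall j w m, exists u m', V m u /\ forall r, V m' r -> E j (w * u * r)%g) ->
  exists g, forall j, E j g.
Proof.
move=> HE.
have step (js : nat * (G * nat)) : exists s' : G * nat,
    [/\ V js.2.2 (js.2.1^-1 * s'.1)%g, (js.2.2 <= s'.2)%N, (js.1 < s'.2)%N,
      (forall r, V s'.2 r -> E js.1 (s'.1 * r)%g) &
      (forall r x, V s'.2 r -> agree js.1.+1 (s'.1 (r x)) (s'.1 x))].
  case: js => j [w m] /=; have [u [m' [Vu uE]]] := HE j w m.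
  have [p pP] := agree_modulus (w * u)%g j.+1.
  exists ((w * u)%g, maxn (maxn m' p) (maxn m j.+1)); split=> /=.
  - by rewrite mulKg.
  - by rewrite !leq_max leqnn !orbT.
  - by rewrite !leq_max leqnn !orbT.
  - by move=> r Vr; apply: uE; apply: V_le Vr; rewrite !leq_max leqnn.
  - by move=> r x Vr; apply: pP; apply: V_le Vr; rewrite !leq_max leqnn ?orbT.
have [f fP] := choice step.
pose s := fix s j : G * nat := if j is k.+1 then f (k, s k) else (1%g, 0).
have sP j := fP (j, s j).
have [|l|l|l|l|l|g gP] := @fusion (fun j => (s j).1) (fun j => V (s j).2).
- by move=> l; exact: subgp_V.
- exact: seq_closed_V.
- by have [_ H _ _ _] := sP l; move=> r; exact: V_le.
- by have [H _ _ _ _] := sP l.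
- by case: l => [|l] r; [exact: V_le|apply: V_le; have [_ _ H _ _] := sP l].
- by case: l => [|l] r x Vr //; have [_ _ _ _ H] := sP l; exact: H.
exists g => j; rewrite -[g](mulVKg (s j.+1).1).
by have [_ _ _ H _] := sP j; exact: H (gP j.+1).
Qed.

Definition rung (n j : nat) : set X :=
  [set x | (forall i, (i < j)%N -> x (n + i)%N = false) /\ x (n + j)%N = true].

Lemma rung_inj n i j x : rung n i x -> rung n j x -> i = j.
Proof.
move=> [iF iT] [jF jT]; have [ij|ij|//] := ltngtP i j.
  by have := jF i ij; rewrite iT.
by have := iF j ij; rewrite jT.
Qed.

Lemma det_rung n j : det (n + j).+1 (rung n j).
Proof.
move=> x y xy [xF xT]; split=> [i ij|]; rewrite -xy ?ltnS ?leq_add2l //.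
  exact: xF.
exact: ltnW.
Qed.

Lemma hits_rung n j : hits n (rung n j).
Proof.
move=> x; exists (splice n x (fun i => i == j)).
  exact/agree_sym/splice_agree.
split=> [i ij|]; rewrite /splice ltnNge leq_addr /= addKn ?eqxx //.
exact: ltn_eqF.
Qed.

Lemma hits_rungC n j : hits n (~` rung n j).
Proof.
move=> x; exists (splice n x (fun i => false)).
  exact/agree_sym/splice_agree.
by move=> [_]; rewrite /splice ltnNge leq_addr.
Qed.

(** If every [S j] missed some [h j] on [rung n j], gluing the [h j] would give one homeomorphism
    that lies in no [S j]. *)
Lemma full_diagonal n (S : nat -> set G) : (forall g, exists j, S j g) ->
  exists j, full n (rung n j) (S j).
Proof.
move=> Scov; apply: contrapT => nfull.
have /choice[h hP] : forall j, exists h, [/\ V n h, supp h (rung n j) &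
    forall g, S j g -> ~ forall x, rung n j x -> g x = h x].
  move=> j; apply: contrapT => nh; apply: nfull; exists j => h Vh hj.
  apply: contrapT => ng; apply: nh; exists h; split=> // g Sg gh.
  by apply: ng; exists g.
have hV j : V j (h j).
  have [Vh hj _] := hP j; move=> x.
  have [jx|njx] := pselect (rung n j x); last by rewrite (hj x njx).
  have [xF _] := jx; have [hF _] := supp_stable hj jx; move=> i ij.
  have [ni|ni] := ltnP i n; first exact: Vh.
  have ijn : (i - n < j)%N by exact: leq_ltn_trans (leq_subr _ _) ij.
  by have := xF _ ijn; have := hF _ ijn; rewrite subnKC // => -> ->.
have hS j : supp (h j) (rung n j) by have [] := hP j.
have [f [fA _]] := homeo_glue (@rung_inj n) hS hV.
have [j Sf] := Scov f; have [_ _ /(_ f Sf)] := hP j.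
by apply; exact: fA.
Qed.

(** Category makes some [Sj j] somewhere dense, and the diagonal argument makes some [Sj i] full;
    passing to quotients gives both properties to [S], and [full_open] applies. *)
Lemma steinhaus (Sj : nat -> set G) (S : set G) :
    (forall g, exists j, Sj j g) -> (forall g, S g -> S g^-1%g) ->
    (forall j f g, Sj j f -> Sj j g -> S (f^-1 * g)%g) ->
  exists M, V M `<=` set_exp S 18.
Proof.
move=> Scov SV SS.
have [j [w [n Sd]]] : exists j w n, forall u, V n u -> forall m,
    exists2 r, V m r & Sj j (w * u * r)%g.
  apply: contrapT => nd; have [|g gS] := @baire_homeo (fun j => ~` Sj j).
    move=> j w m; apply: contrapT => nu; apply: nd; exists j, w, m => u Vu m'.
    apply: contrapT => nr; apply: nu; exists u, m'; split=> // r Vr Sr.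
    by apply: nr; exists r.
  by have [j] := Scov g; exact: gS.
have dense phi m : V n phi -> exists2 g, S g & V m (phi^-1 * g)%g.
  (* Elements of [Sj j] near [w] and near [w * phi] have a quotient near [phi]; [p] keeps the first
     error small after conjugation by [phi^-1]. *)
  move=> Vphi; have [p pP] := V_conj phi^-1%g m.
  have [r1 Vr1 S1] := Sd 1%g (@V1 n) p; have [r2 Vr2 S2] := Sd phi Vphi m.
  exists ((w * 1 * r1)^-1 * (w * phi * r2))%g; first exact: (SS j).
  have -> : (phi^-1 * ((w * 1 * r1)^-1 * (w * phi * r2)) =
      phi^-1 * r1^-1 * phi * r2)%g.
    by rewrite mulg1 invgM !mulgA mulgVK.
  by apply: VM => //; have := pP r1^-1%g; rewrite invgK; apply; exact: VV.
have [i fulli] := full_diagonal n Scov.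
have fullS : full n (rung n i) S.
  move=> h Vh hi; have [g Sg gh] := fulli h Vh hi.
  have [k Sk k1] := fulli 1%g (@V1 n) (fun _ _ => erefl).
  exists (k^-1 * g)%g; first exact: (SS i).
  move=> x ix; rewrite mul_homeoE gh //; apply: (@homeo_inj k).
  by rewrite homeo_VK k1 //; exact: supp_stable.
have [phi [psi [m [M [Vphi Vpsi H]]]]] :=
  full_open (@det_rung n i) (hits_rung n i) (@hits_rungC n i).
by exists M; apply: H => //; exact: dense.
Qed.

(** * Automatic continuity and the Bergman property *)

Lemma set_exp_mono (H : groupType) (A B : set H) n :
  A `<=` B -> set_exp A n `<=` set_exp B n.
Proof. by move=> AB g [w wA <-]; exists w => // i; exact/AB/wA. Qed.

Section TopologicalGroups.
Variable H : topologicalGroupType.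
Implicit Types (O U : set H) (h : H).

Lemma mul_nbhs1 O : nbhs (1%g : H) O ->
  exists2 U, nbhs (1%g : H) U & forall a b, U a -> U b -> O (a * b)%g.
Proof.
move=> nO; have : nbhs ((1%g, 1%g) : H * H) [set p | O (p.1 * p.2)%g].
  by apply: (@mulg_continuous H (1%g, 1%g)); rewrite /= mulg1.
move=> [[A B] [/= nA nB] AB]; exists (A `&` B); first exact: filterI.
by move=> a b [Aa _] [_ Bb]; exact: (AB (a, b)).
Qed.

Lemma inv_nbhs1 O : nbhs (1%g : H) O -> nbhs (1%g : H) [set h | O h^-1%g].
Proof. by move=> nO; apply: (@invg_continuous H 1%g); rewrite /= invg1. Qed.

Lemma mulr_nbhs h O : nbhs h O -> nbhs (1%g : H) [set a | O (a * h)%g].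
Proof.
move=> nO; have : nbhs ((1%g, h) : H * H) [set p | O (p.1 * p.2)%g].
  by apply: (@mulg_continuous H (1%g, h)); rewrite /= mul1g.
move=> [[A B] [/= nA nB] AB]; apply: filterS nA => a Aa.
by apply: (AB (a, h)); split=> //=; exact: nbhs_singleton nB.
Qed.

Lemma mull_nbhs h O : nbhs (1%g : H) O -> nbhs h [set a | O (h^-1 * a)%g].
Proof.
move=> nO; have : nbhs ((h^-1%g, h) : H * H) [set p | O (p.1 * p.2)%g].
  by apply: (@mulg_continuous H (h^-1%g, h)); rewrite /= mulVg.
move=> [[A B] [/= nA nB] AB]; apply: filterS nB => b Bb.
by apply: (AB (h^-1%g, b)); split=> //=; exact: nbhs_singleton nA.
Qed.

Lemma set_exp_nbhs1 n O : nbhs (1%g : H) O ->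
  exists2 U, nbhs (1%g : H) U & set_exp U n `<=` O.
Proof.
elim: n O => [|n IHn] O nO.
  exists setT; first exact: filterT.
  by move=> _ [w _ <-]; rewrite big_ord0; exact: nbhs_singleton nO.
have [U1 nU1 U1O] := mul_nbhs1 nO; have [U2 nU2 U2O] := IHn _ nU1.
exists (U1 `&` U2); first exact: filterI.
move=> _ [w wU <-]; rewrite big_ord_recl; apply: U1O.
  by have [] := wU ord0.
apply: U2O; exists (fun i => w (lift ord0 i)) => // i.
by have [] := wU (lift ord0 i).
Qed.

End TopologicalGroups.

(** [S] is the preimage of [U * U^-1] for a small neighbourhood [U] of 1. The preimages of the sets
    [d j * U^-1] cover the group as the [d j] are dense, and their quotients lie in [S]; so some
    [V M] inside [S^18] is mapped near 1. *)
Lemma automatic_continuity (H : topologicalGroupType)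
  (f : {multiplicative G -> H}) : separable H -> continuous f.
Proof.
move=> [D cD dD] g O nO.
have f1 : f 1%g = 1%g by apply: (mulgI (f 1%g)); rewrite -gmulfM !mulg1.
have fV k : f (k^-1)%g = ((f k)^-1)%g.
  by apply: (mulgI (f k)); rewrite -gmulfM !mulgV.
have [U0 nU0 U0O] := set_exp_nbhs1 18 (mulr_nbhs nO).
have [U1 nU1 U1O] := mul_nbhs1 nU0.
pose U := U1 `&` [set h | U1 h^-1%g].
have nU : nbhs (1%g : H) U by apply: filterI => //; exact: inv_nbhs1.
have [d dP] : exists d : nat -> H, forall x, D x -> exists j, d j = x.
  have /pfcard_geP[D0|[d]] := cD.
    have [x [_]] : setT `&` D !=set0.
      by apply: dD; [exists 1%g|exact: openT].
    by rewrite D0.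
  by exists d => x /(@surj _ _ _ _ d)[j _ <-]; exists j.
pose S := [set k : G | exists a b, [/\ U a, U b & f k = (a * b^-1)%g]].
have [|k|j k l Sk Sl|M VM] :=
  @steinhaus (fun j => [set k : G | U ((f k)^-1 * d j)%g]) S.
- move=> k; have : nbhs (f k) [set h | U ((f k)^-1 * h)%g] by exact: mull_nbhs.
  rewrite nbhsE => -[B [oB Bk] BU].
  have [x [Bx Dx]] : B `&` D !=set0 by apply: dD => //; exists (f k).
  by have [j dj] := dP x Dx; exists j; rewrite /= dj; exact: BU.
- move=> [a [b [Ua Ub fk]]]; exists b, a; split=> //.
  by rewrite fV fk invgM invgK.
- exists ((f k)^-1 * d j)%g, ((f l)^-1 * d j)%g; split=> //.
  by rewrite gmulfM fV invgM invgK mulgA mulgK.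
have SU : [set f k | k in S] `<=` U0.
  move=> _ [k [a [b [Ua Ub fk]]] <-]; rewrite fk; apply: U1O.
    by case: Ua.
  by case: Ub.
apply: filterS (nbhs_V g M) => k kg.
rewrite /= -[k](mulgVK g) gmulfM; apply: U0O; apply: set_exp_mono SU _ _.
have [|w wS <-] := VM (k * g^-1)%g.
  by move=> x; have := kg (g^-1%g x); rewrite homeo_VK.
exists (fun i => f (w i)); last by rewrite (big_morph f (@gmulfM _ _ f) f1).
by move=> i; exists (w i).
Qed.

(** Colour a point by the cylinders of level [M] of itself and of its image. The recolouring [u]
    from [g] to [f] preserves the first component, and [g * (f * u)^-1] lies in [V M] because of the
    second. *)
Lemma double_coset M (f g : G) :
    (forall x, exists y, agree M x y /\ agree M (g x) (f y)) ->
    (forall x, exists y, agree M x y /\ agree M (f x) (g y)) ->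
  exists u v, [/\ V M u, V M v & g = (v * f * u)%g].
Proof.
move=> gf fg.
pose P (h : G) x := (mkseq x M, mkseq (h x) M).
have [m mP] := homeo_unif g M; have [k kP] := homeo_unif f M.
have [x y xy|x y xy|x|x|u uP] := @recolor _ (maxn M (maxn m k)) (P g) (P f).
- congr pair; apply/agree_mkseq; [|apply: mP]; apply: agree_le xy;
    by rewrite !leq_max leqnn ?orbT.
- congr pair; apply/agree_mkseq; [|apply: kP]; apply: agree_le xy;
    by rewrite !leq_max leqnn ?orbT.
- have [y [xy gfy]] := gf x; exists y.
  by congr pair; apply/agree_mkseq; exact: agree_sym.
- have [y [xy gfy]] := fg x; exists y.
  by congr pair; apply/agree_mkseq; exact: agree_sym.
exists u, (g * (f * u)^-1)%g; split.
- by move=> x; have [/agree_mkseq] := uP x.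
- move=> x; rewrite -{2}(homeo_VK (f * u)%g x) mul_homeoE.
  set y := _ x; rewrite mul_homeoE; apply: agree_sym.
  by have [_ /agree_mkseq] := uP y.
by rewrite -mulgA mulgVK.
Qed.

(** The targets [phi] and [psi] of [full_open] themselves lie in some [W' k], which takes the place
    of density. As [V M] has finitely many double cosets, one [W' K] meets them all. *)
Lemma bergman (W : nat -> set G) : (forall k, W k `<=` W k.+1) ->
  [set: G] = \bigcup_k W k -> exists n k, [set: G] = set_exp (W k) n.
Proof.
move=> Winc Wcov.
have Wle i j : (i <= j)%N -> W i `<=` W j.
  move=> /subnKC <-; elim: (j - i)%N => [|d IH]; first by rewrite addn0.
  by rewrite addnS => g /IH /Winc.
pose W' k := W k `&` [set g | W k g^-1%g].
have W'le i j : (i <= j)%N -> W' i `<=` W' j.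
  by move=> ij g [Wg Wg']; split; exact: Wle Wg || exact: Wle Wg'.
have W'cov g : exists k, W' k g.
  have [i _ Wi] : (\bigcup_k W k) g by rewrite -Wcov.
  have [j _ Wj] : (\bigcup_k W k) g^-1%g by rewrite -Wcov.
  exists (maxn i j); split; first by apply: Wle Wi; exact: leq_maxl.
  by apply: Wle Wj; exact: leq_maxr.
have W'V k g : W' k g -> W' k g^-1%g by move=> [Wg Wg']; rewrite /W' /= invgK.
have [j fullj] := full_diagonal 0 W'cov.
have [phi [psi [m [M [_ _ H]]]]] :=
  full_open (@det_rung 0 j) (@hits_rung 0 j) (@hits_rungC 0 j).
have [k1 Wphi] := W'cov phi; have [k2 Wpsi] := W'cov psi.
pose k0 := maxn j (maxn k1 k2).
have VMW : V M `<=` set_exp (W' k0) 18.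
  apply: H.
  - exact: W'V.
  - move=> h Vh hj; have [g Sg gh] := fullj h Vh hj; exists g => //.
    by apply: W'le Sg; exact: leq_maxl.
  - exists phi; last by rewrite mulVg.
    by apply: W'le Wphi; rewrite !leq_max leqnn ?orbT.
  - exists psi; last by rewrite mulVg.
    by apply: W'le Wpsi; rewrite !leq_max leqnn ?orbT.
pose tup (x : X) := [tuple x i | i < M].
have tupP x y : tup x = tup y -> agree M x y.
  move=> xy i iM; have := congr1 (fun t => tnth t (Ordinal iM)) xy.
  by rewrite !tnth_mktuple.
(* The set of pairs of cylinders of level [M] that [g] links takes finitely many values and
   determines the double coset of [g]. *)
pose pat (g : G) := [set p : M.-tuple bool * M.-tuple bool |
  `[< exists x, (tup x, tup (g x)) = p >]]%SET.
have patP f g x : pat g = pat f ->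
    exists y, agree M x y /\ agree M (g x) (f y).
  move=> gf; have : (tup x, tup (g x)) \in pat g.
    by rewrite inE; apply/asboolP; exists x.
  rewrite gf inE => /asboolP[y E]; exists y.
  split; apply/agree_sym/tupP; first exact: (congr1 (fun p => p.1) E).
  exact: (congr1 (fun p => p.2) E).
have /choice[kap kapP] : forall p, exists k, (exists g, pat g = p) ->
    exists2 f, W' k f & pat f = p.
  move=> p; have [[g gp]|ng] := pselect (exists g, pat g = p).
    by have [k Wk] := W'cov g; exists k => _; exists g.
  by exists 0 => /ng.
pose K := maxn k0 (\max_p kap p).
(* 37 = 18 + 1 + 18, for [v * f * u]. *)
exists 37, K; apply/seteqP; split=> // g _.
have [f Wf fg] : exists2 f, W' (kap (pat g)) f & pat f = pat g.
  by apply: kapP; exists g.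
have [x|x|u [v [Vu Vv ->]]] := @double_coset M f g; [exact: patP|exact: patP|].
have sub n : set_exp (W' K) n `<=` set_exp (W K) n.
  by apply: set_exp_mono => h [].
have VMK h : V M h -> set_exp (W' K) 18 h.
  move=> /VMW; apply: set_exp_mono; apply: W'le; exact: leq_maxl.
apply: sub; apply: (@set_expM _ 19 18); last exact: VMK.
apply: (@set_expM _ 18 1); first exact: VMK.
apply: set_exp1; apply: W'le Wf; apply: leq_trans (leq_maxr _ _).
exact: (@leq_bigmax _ kap (pat g)).
Qed.

(** * Slaved subgroups *)

(* A Cantor scheme: [h a] lies in [v R] for the condition (v, R) attached to
   each initial segment of [a], and the two extensions of a node of level [l]
   are chosen so that their ratio avoids [Bad l]. *)
Lemma cantor_scheme (RR : set (set G)) (Bad : nat -> set G) :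
    (exists R, RR R) ->
    (forall R, RR R -> is_subgp R /\ seq_closed R) ->
    (forall R m, RR R -> exists2 R', RR R' & R' `<=` R `&` V m) ->
    (forall l v R, RR R -> exists s R', [/\ R s, RR R', R' `<=` R &
      forall r, R' r -> ~ Bad l (v * s * r * v^-1)%g]) ->
  exists h : X -> G,
    (forall l a b, agree l a b -> V l ((h a)^-1 * h b)%g) /\
    (forall l a b, agree l a b -> a l = false -> b l = true ->
      ~ Bad l (h b * (h a)^-1)%g).
Proof.
move=> [R0 RR0] RRg RRV RRs.
pose child (l : nat) (c c' : G * set G) :=
  [/\ RR c'.2, c'.2 `<=` c.2, c.2 (c.1^-1 * c'.1)%g, c'.2 `<=` V l.+1 &
    forall r x, c'.2 r -> agree l.+1 (c'.1 (r x)) (c'.1 x)].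
have step (lc : nat * (G * set G)) : exists c' : bool -> G * set G,
    RR lc.2.2 -> (forall b, child lc.1 lc.2 (c' b)) /\
    forall r0 r1, (c' false).2 r0 -> (c' true).2 r1 ->
      ~ Bad lc.1 ((c' true).1 * r1 * ((c' false).1 * r0)^-1)%g.
  case: lc => l [v R] /=; have [RRR|] := pselect (RR R); last first.
    by exists (fun=> (1%g, R)).
  have [s [R' [Rs RR' R'R sBad]]] := RRs l v R RRR.
  have [p pP] := agree_modulus (v * 1)%g l.+1.
  have [q qP] := agree_modulus (v * s)%g l.+1.
  have [R'' RR'' R''V] := RRV R' (maxn l.+1 (maxn p q)) RR'.
  have [[R1 RM RI] _] := RRg _ RRR; have [[_ RM'' RI''] _] := RRg _ RR''.
  (* The children have centres [v] and [v * s] and the same group, so a ratio of members is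
     [v * s * r1 * r0^-1 * v^-1], with [r1 * r0^-1] in [R']. *)
  exists (fun b => ((v * if b then s else 1)%g, R'')) => _; split=> [b|] /=.
    split=> //= [r /R''V[/R'R]//||r /R''V[_]|r x /R''V[_ Vr]].
    - by rewrite mulKg; case: b.
    - by apply: V_le; rewrite leq_maxl.
    - case: b; [apply: qP|apply: pP]; apply: V_le Vr;
        by rewrite !leq_max leqnn ?orbT.
  move=> r0 r1 R0' R1'; rewrite mulg1 invgM mulgA -(mulgA _ r1).
  apply: sBad.
  by have [] : (R' `&` V (maxn l.+1 (maxn p q))) (r1 * r0^-1)%g
    by apply: R''V; apply: RM'' => //; exact: RI''.
have [f fP] := choice step.
pose s (a : X) := fix s l : G * set G :=
  if l is k.+1 then f (k, s k) (a k) else (1%g, R0).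
have sS a l : s a l.+1 = f (l, s a l) (a l) by [].
have sRR a l : RR (s a l).2.
  elim: l => // l IH; rewrite sS.
  by have [/(_ (a l))[]] := fP (l, s a l) IH.
have sP a l : child l (s a l) (s a l.+1).
  by rewrite sS; have [/(_ (a l))] := fP (l, s a l) (sRR a l).
have /choice[h hP] a : exists g : G, forall l, (s a l).2 ((s a l).1^-1 * g)%g.
  apply: (@fusion (fun l => (s a l).1) (fun l => (s a l).2)) => l.
  - by have [] := RRg _ (sRR a l).
  - by have [] := RRg _ (sRR a l).
  - by have [] := sP a l.
  - by have [] := sP a l.
  - by case: l => [|l] r //; have [_ _ _ + _] := sP a l; apply.
  - by case: l => [|l] r x // Rr; have [_ _ _ _] := sP a l; apply.
have sE l a b : agree l a b -> s a l = s b l.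
  elim: l => // l IH ab; rewrite !sS IH; last exact: agree_le ab.
  by rewrite (ab l).
exists h; split=> [l a b ab|l a b ab al bl].
  have -> : ((h a)^-1 * h b =
      ((s a l).1^-1 * h a)^-1 * ((s b l).1^-1 * h b))%g.
    by rewrite (sE _ _ _ ab) invgM invgK -mulgA mulVKg.
  have sV c : V l ((s c l).1^-1 * h c)%g.
    case: l {ab} => [|l] //; have [_ _ _ + _] := sP c l; apply; exact: hP.
  by apply: VM => //; exact: VV.
have [_ sBad] := fP (l, s a l) (sRR a l).
have := hP a l.+1; have := hP b l.+1; rewrite !sS -(sE _ _ _ ab) al bl.
move=> Hb Ha; have := sBad _ _ Ha Hb.
by rewrite !mulVKg.
Qed.

(* [X / E] looks like [X]: the quotient map is open, and injective on cylinders
   of level [m]. The group [slaved E m] is large, since a homeomorphism of a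
   small cylinder can be copied along the classes of [E]. *)
Record adm (E : X -> X -> Prop) (m : nat) : Prop := Adm {
  adm_refl : forall x, E x x;
  adm_sym : forall x y, E x y -> E y x;
  adm_trans : forall x y z, E x y -> E y z -> E x z;
  adm_inj : forall x y, agree m x y -> E x y -> x = y;
  adm_lift : forall p, exists N, forall x c c', E x c -> agree N c c' ->
    exists2 x', agree p x x' & E x' c' }.

Definition slaved (E : X -> X -> Prop) (m : nat) : set G :=
  V m `&` [set g | forall x y, E x y <-> E (g x) (g y)].

Lemma adm_eq : adm eq 0.
Proof.
split=> // [x y z -> //|p].
by exists p => x c c' -> cc'; exists c'.
Qed.

Lemma adm_le E m n : (m <= n)%N -> adm E m -> adm E n.
Proof. by move=> mn [? ? ? H ?]; split=> // x y /(agree_le mn); exact: H. Qed.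

Lemma slaved_le E m n : (m <= n)%N -> slaved E n `<=` slaved E m.
Proof. by move=> mn g [Vg Eg]; split=> //; exact: V_le Vg. Qed.

Lemma subgp_slaved E m : is_subgp (slaved E m).
Proof.
split=> [|f g [Vf Ef] [Vg Eg]|g [Vg Eg]].
- by split; [exact: V1|].
- by split; [exact: VM|move=> x y; rewrite Eg Ef].
- by split; [exact: VV|move=> x y; rewrite (Eg (_ x)) !homeo_VK].
Qed.

Section Admissible.
Variables (E : X -> X -> Prop) (m : nat).
Hypothesis admE : adm E m.

Let Er := adm_refl admE.
Let Es := adm_sym admE.
Let Et := adm_trans admE.
Let Ei := adm_inj admE.
Let El := adm_lift admE.

(** Lifting nearby pairs gives points [z] arbitrarily near [x] with [E z y]; since such a point is
    unique in its cylinder of level [m], it is [x] itself. *)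
Lemma adm_closed x y :
  (forall p, exists x' y', [/\ agree p x x', agree p y y' & E x' y']) -> E x y.
Proof.
move=> H.
have near p : exists2 z, agree p x z & E z y.
  have [N NP] := El p; have [x' [y' [xx' yy' Exy]]] := H (maxn p N).
  have [|x'' x'x'' Ex''] := NP x' y' y Exy.
    by apply/agree_sym; apply: agree_le yy'; exact: leq_maxr.
  exists x'' => //; apply: agree_trans x'x''.
  by apply: agree_le xx'; exact: leq_maxl.
have [z xz Ezy] := near m; suff -> : x = z by [].
apply: agree_eq => p; have [z' xz' Ez'y] := near (maxn p m).
suff -> : z = z' by apply: agree_le xz'; exact: leq_maxl.
apply: Ei; last exact: Et Ezy (Es Ez'y).
apply: agree_trans (agree_sym xz) _.
by apply: agree_le xz'; exact: leq_maxr.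
Qed.

Lemma seq_closed_slaved : seq_closed (slaved E m).
Proof.
move=> g gR; have [_ _ RV] := subgp_slaved E m; split.
  by apply: seq_closed_V => p; have [r [Vr _] Vg] := gR p; exists r.
move=> x y; split=> Exy; apply: adm_closed => p.
  have [M MP] := homeo_unif g p; have [r [_ Er'] Vb] := gR M.
  have rE z : r z = g ((r^-1 * g)^-1%g z).
    by rewrite -mul_homeoE invgM invgK mulVKg.
  exists (r x), (r y); split; last exact: (iffLR (Er' _ _) Exy).
    by rewrite rE; apply: MP; apply/agree_sym/(VV Vb).
  by rewrite rE; apply: MP; apply/agree_sym/(VV Vb).
have [r rR Vb] := gR p; have [_ Er'] := RV _ rR.
exists ((r^-1 * g)%g x), ((r^-1 * g)%g y); split.
- exact/agree_sym/Vb.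
- exact/agree_sym/Vb.
- by rewrite !mul_homeoE; exact: (iffLR (Er' _ _) Exy).
Qed.

(** A cylinder of level at least [m] contains at most one point equivalent to [z], and flipping one
    more bit leaves it behind. The points of [L] are treated one at a time. *)
Lemma adm_avoid (L : seq X) x n : exists y q, [/\ (n <= q)%N, agree n x y &
  forall y' z, agree q y y' -> z \in L -> ~ E y' z].
Proof.
elim: L => [|z L [y [q [nq xy yL]]]]; first by exists x, n.
pose q' := maxn q m.
have [[y0 yy0 Ey0]|nE] := pselect (exists2 y0, agree q' y y0 & E y0 z).
  exists (set_bit q' (~~ y0 q') y0), q'.+1; split.
  - by rewrite leqW // leq_max nq.
  - apply: agree_trans xy _; apply: (@agree_le _ q'); first by rewrite leq_max nq.
    by apply: agree_trans yy0 _; exact: set_bit_agree.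
  - move=> y' z' y0y'; have yy' : agree q' y0 y'.
      apply: agree_trans (set_bit_agree (~~ y0 q') _ (leqnn q')) _.
      exact: agree_le y0y'.
    rewrite inE => /predU1P[->{z'}|z'L].
      move=> Ey'; have := Ei _ (Et Ey0 (Es Ey')).
      move=> /(_ (agree_le (leq_maxr _ _) yy')) E0.
      have := y0y' q' (ltnSn _); rewrite set_bit_eq -E0.
      by case: (y0 q').
    apply: yL z'L; apply: (@agree_le _ q'); first exact: leq_maxl.
    exact: agree_trans yy0 yy'.
exists y, q'; split=> //; first by rewrite leq_max nq.
move=> y' z' yy'; rewrite inE => /predU1P[->{z'}|z'L].
  by move=> Ey'; apply: nE; exists y'.
by apply: yL z'L; apply: agree_le yy'; exact: leq_maxl.
Qed.

(** One point is chosen in each cylinder of level [n], pairwise inequivalent by [adm_avoid], and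
    thickened to a cylinder so small that, [E] being closed, inequivalence persists. *)
Lemma adm_transversal n N : exists C N1, [/\ (N <= N1)%N, det N1 C, hits n C,
  (forall x y, C x -> C y -> agree n x y -> agree N1 x y) &
  (forall x y, C x -> C y -> E x y -> x = y)].
Proof.
pose tup (x : X) := [tuple x i | i < n].
have tupP x y : tup x = tup y -> agree n x y.
  move=> xy i im; have := congr1 (fun t => tnth t (Ordinal im)) xy.
  by rewrite !tnth_mktuple.
have [L [Lhit Ln LE]] : exists L : seq X,
    [/\ forall x, exists2 y, y \in L & agree n x y,
      forall x y, x \in L -> y \in L -> agree n x y -> x = y &
      forall x y, x \in L -> y \in L -> E x y -> x = y].
  suff H (s : seq (n.-tuple bool)) : exists L : seq X,
    [/\ forall x, tup x \in s -> exists2 y, y \in L & agree n x y,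
      forall x y, x \in L -> y \in L -> agree n x y -> x = y &
      forall x y, x \in L -> y \in L -> E x y -> x = y].
    have [L [Lhit Ln LE]] := H (enum {: n.-tuple bool}); exists L; split=> // x.
    by apply: Lhit; rewrite mem_enum.
  elim: s => [|t s [L [Lhit Ln LE]]]; first by exists [::].
  have [[x0 tx0]|nt] := pselect (exists x0, tup x0 = t); last first.
    exists L; split=> // x; rewrite inE => /predU1P[tx|]; last exact: Lhit.
    by case: nt; exists x.
  have [[y0 y0L xy0]|nL] := pselect (exists2 y0, y0 \in L & agree n x0 y0).
    exists L; split=> // x; rewrite inE => /predU1P[tx|]; last exact: Lhit.
    by exists y0 => //; apply: agree_trans xy0; apply: tupP; rewrite tx.
  have [y [q [nq x0y yL]]] := adm_avoid L x0 n.
  have yE z : z \in L -> ~ E y z by exact: yL.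
  exists (y :: L); split=> [x|x z|x z]; rewrite !inE.
  - move=> /predU1P[tx|/Lhit[z zL xz]]; last by exists z => //; rewrite inE zL orbT.
    exists y; rewrite ?inE ?eqxx //; apply: agree_trans x0y.
    by apply: tupP; rewrite tx.
  - move=> /predU1P[->|xL] /predU1P[->|zL] //; last exact: Ln.
      by move=> yz; case: nL; exists z => //; exact: agree_trans yz.
    move=> xy; case: nL; exists x => //; apply: agree_trans x0y _.
    exact: agree_sym.
  - move=> /predU1P[->|xL] /predU1P[->|zL] //; last exact: LE.
      by move=> /(yE _ zL).
    by move=> /Es /(yE _ xL).
have fin (P : X -> nat -> Prop) :
    (forall x p q, (p <= q)%N -> P x p -> P x q) ->
    (forall x, exists p, P x p) -> forall s : seq X,
    exists p, forall x, x \in s -> P x p.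
  move=> Pmono PE; elim=> [|x s [p pP]]; first by exists 0.
  have [q qP] := PE x; exists (maxn p q) => y; rewrite inE => /predU1P[->|ys].
    by apply: Pmono qP; exact: leq_maxr.
  by apply: Pmono (pP y ys); exact: leq_maxl.
pose sep x y p := x <> y -> E x y \/
  (forall x' y', agree p x x' -> agree p y y' -> ~ E x' y').
have sep_mono x y p q : (p <= q)%N -> sep x y p -> sep x y q.
  move=> pq H /H[|{}H]; [by left|right] => x' y' xx' yy'.
  by apply: H; [exact: agree_le xx'|exact: agree_le yy'].
have sepE x y : exists p, sep x y p.
  apply: contrapT => nsep; have nE : ~ E x y.
    by move=> Exy; apply: nsep; exists 0 => _; left.
  apply: nE; apply: adm_closed => p; apply: contrapT => np.
  apply: nsep; exists p => _; right=> x' y' xx' yy' Exy.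
  by apply: np; exists x', y'.
have [p0 p0P] := fin (fun x p => forall y, y \in L -> sep x y p)
  (fun x p q pq H y yL => sep_mono _ _ _ _ pq (H y yL))
  (fun x => fin (sep x) (sep_mono x) (sepE x) L) L.
pose N1 := maxn (maxn p0 N) (maxn m n).
exists [set z | exists2 x, x \in L & agree N1 x z], N1; split.
- by rewrite !leq_max leqnn ?orbT.
- by move=> x y xy [z zL zx]; exists z => //; exact: agree_trans xy.
- by move=> x; have [y yL xy] := Lhit x; exists y => //; exists y.
- move=> x y [a aL ax] [b bL b_y] xy; suff ab : a = b.
    by rewrite -ab in b_y; exact: agree_trans (agree_sym ax) b_y.
  have nN1 : (n <= N1)%N by rewrite !leq_max leqnn ?orbT.
  apply: Ln => //; apply: agree_trans (agree_le nN1 ax) _.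
  by apply: agree_trans xy _; apply/agree_sym; exact: agree_le b_y.
- move=> x y [a aL ax] [b bL b_y] Exy; have [ab|nab] := pselect (a = b).
    apply: Ei Exy; rewrite -ab in b_y.
    apply: (@agree_le _ N1); first by rewrite !leq_max leqnn ?orbT.
    exact: agree_trans (agree_sym ax) b_y.
  have pN1 : (p0 <= N1)%N by rewrite !leq_max leqnn ?orbT.
  have [/LE|H] := p0P a aL b bL nab; first by move=> /(_ aL bL).
  by case: (H x y _ _ Exy); [exact: agree_le ax|exact: agree_le b_y].
Qed.

(** A point equivalent to [c] in [C] has to go to the point of its own cylinder of level [m]
    equivalent to [h c], which exists by lifting and is unique by injectivity; points not linked to
    [C] stay fixed. *)
Lemma slaved_extend : exists N, forall C h N1, det N1 C ->
    (forall x y, C x -> C y -> E x y -> x = y) -> supp h C -> V N h ->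
  exists2 s, slaved E m s & forall x, C x -> s x = h x.
Proof.
have [N0 N0P] := El m; exists (maxn N0 m) => C h N1 dC CE hC Vh.
pose spec1 (h : G) (x y : X) :=
  (forall c, C c -> E x c -> agree m x y /\ E y (h c)) /\
  ((forall c, C c -> ~ E x c) -> y = x).
pose spec (h : G) (s : X -> X) := forall x, spec1 h x (s x).
have specex k : V (maxn N0 m) k -> exists s, spec k s.
  move=> Vk; suff /choice[s sP] : forall x, exists y, spec1 k x y by exists s.
  move=> x.
  have [[c [Cc Exc]]|nC] := pselect (exists c, C c /\ E x c); last first.
    by exists x; split=> // c Cc Exc; case: nC; exists c.
  have [|y xy Ey] := N0P x c (k c) Exc.
    by apply/agree_sym; apply: agree_le (Vk c); exact: leq_maxl.
  exists y; split=> [c' Cc' Exc'|/(_ c Cc)//].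
  by have -> : c' = c by apply: CE => //; exact: Et (Es Exc') Exc.
have specm k s x : spec k s -> agree m x (s x).
  move=> sk; have [[c [Cc Exc]]|nC] := pselect (exists c, C c /\ E x c).
    by have [/(_ c Cc Exc)[]] := sk x.
  have [_ ->] := sk x; first exact: agree_refl.
  by move=> c Cc Exc; apply: nC; exists c.
have specE k s x y : spec k s -> E x y -> E (s x) (s y).
  move=> sk Exy; have [[c [Cc Exc]]|nC] := pselect (exists c, C c /\ E x c).
    have [/(_ c Cc Exc)[_ Esx] _] := sk x.
    have [/(_ c Cc (Et (Es Exy) Exc))[_ Esy] _] := sk y.
    exact: Et Esx (Es Esy).
  have [_ ->] := sk x; last by move=> c Cc Exc; apply: nC; exists c.
  have [_ ->] := sk y => // c Cc Eyc; apply: nC; exists c; split=> //.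
  exact: Et Exy Eyc.
(* If [x] is linked to [c], a nearby [y] is linked to some [d] near [c], and the partner of [k d]
   near [s x] must be [s y]. Not being linked to [C] is an open condition. *)
have speccont k s : spec k s -> cont s.
  move=> sk x n; have [[c [Cc Exc]]|nC] := pselect (exists c, C c /\ E x c).
    have [/(_ c Cc Exc)[xsx Esx] _] := sk x.
    have [Np NpP] := El (maxn n m); have [q qP] := homeo_unif k Np.
    have [Nq NqP] := El (maxn q N1); exists (maxn Nq m) => y xy.
    have [|d cd Edy] := NqP c x y (Es Exc).
      by apply: agree_le xy; exact: leq_maxl.
    have Cd : C d by apply: dC Cc; apply: agree_le cd; exact: leq_maxr.
    have [/(_ d Cd (Es Edy))[ysy Esy] _] := sk y.
    have [|x' sxx' Ex'] := NpP (s x) (k c) (k d) Esx.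
      by apply: qP; apply: agree_le cd; exact: leq_maxl.
    suff -> : s y = x' by apply: agree_le sxx'; exact: leq_maxl.
    apply: Ei; last exact: Et Esy (Es Ex').
    apply: agree_trans (agree_sym ysy) _.
    apply: agree_trans (_ : agree m y x) _.
      by apply/agree_sym; apply: agree_le xy; exact: leq_maxr.
    apply: agree_trans xsx _; apply: agree_le sxx'; exact: leq_maxr.
  have [Nq NqP] := El N1; exists (maxn Nq n) => y xy.
  have [_ ->] := sk x; last by move=> c Cc Exc; apply: nC; exists c.
  have [_ ->] := sk y; first by apply: agree_le xy; exact: leq_maxr.
  move=> c Cc Eyc; have [|d cd Ed] := NqP c y x (Es Eyc).
    by apply/agree_sym; apply: agree_le xy; exact: leq_maxl.
  by apply: nC; exists d; split; [exact: dC Cc|exact: Es].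
have specK (k k' : G) s s' : (forall x, k' (k x) = x) -> supp k C ->
    spec k s -> spec k' s' -> cancel s s'.
  move=> kK kC sk s'k x.
  have [[c [Cc Exc]]|nC] := pselect (exists c, C c /\ E x c).
    have [/(_ c Cc Exc)[xsx Esx] _] := sk x.
    have [/(_ (k c) (supp_stable kC Cc) Esx)[sxs'] ] := s'k (s x).
    rewrite kK => Es'c _; apply: Ei; last exact: Et Es'c (Es Exc).
    exact: agree_trans (agree_sym sxs') (agree_sym xsx).
  have nC' c : C c -> ~ E x c by move=> Cc Exc; apply: nC; exists c.
  have [_ /(_ nC') ->] := sk x.
  by have [_ /(_ nC') ->] := s'k x.
have [s sP] := specex h Vh; have [s' s'P] := specex h^-1%g (VV Vh).
have [g [gE gVE]] := mk_homeo (speccont _ _ sP) (speccont _ _ s'P)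
  (specK _ _ _ _ (homeo_K h) hC sP s'P)
  (specK _ _ _ _ (homeo_VK h) (suppV hC) s'P sP).
exists g.
  split=> [x|x y]; first by rewrite gE; apply/agree_sym/(specm _ _ _ sP).
  split=> [Exy|]; first by rewrite !gE; exact: specE sP Exy.
  by move=> /(specE _ _ _ _ s'P); rewrite -!gVE !homeo_K.
move=> x Cx; have [/(_ x Cx (Er x))[xsx Esx] _] := sP x.
rewrite gE; apply: Ei Esx; apply: agree_trans (agree_sym xsx) _.
by apply/agree_sym; apply: agree_le (Vh x); exact: leq_maxr.
Qed.

End Admissible.

(** Under the hypotheses of the next section this is the equivalence relation generated by [E] and
    the pairs [(a, k a)] with [a] in [A0]; a class joins at most two classes of [E]. *)
Definition adjoin (E : X -> X -> Prop) (A0 : set X) (k : G) (x y : X) :=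
  [\/ E x y, exists2 a, A0 a & E x a /\ E y (k a) |
      exists2 a, A0 a & E y a /\ E x (k a)].

Section Adjoin.
Variables (E : X -> X -> Prop) (m p0 : nat) (C A0 A1 : set X) (k : G).
Hypotheses (admE : adm E m)
  (CE : forall x y, C x -> C y -> E x y -> x = y)
  (A0C : A0 `<=` C) (A1C : A1 `<=` C) (A01 : forall x, A0 x -> ~ A1 x)
  (d0 : det p0 A0) (d1 : det p0 A1) (kA : forall x, A1 (k x) <-> A0 x).

Let Er := adm_refl admE.
Let Es := adm_sym admE.
Let Et := adm_trans admE.
Let Ei := adm_inj admE.
Let El := adm_lift admE.

Let kA1 a : A0 a -> A1 (k a). Proof. by move/(iffRL (kA a)). Qed.

Let Eeq0 a b : A0 a -> A0 b -> E a b -> a = b.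
Proof. by move=> /A0C Ca /A0C Cb; exact: CE. Qed.

Let Eeqk a b : A0 a -> A0 b -> E (k a) (k b) -> a = b.
Proof.
move=> /kA1/A1C Ca /kA1/A1C Cb /(CE Ca Cb).
exact: homeo_inj.
Qed.

Let Ene a b : A0 a -> A0 b -> ~ E a (k b).
Proof.
move=> Aa Ab /(CE (A0C Aa) (A1C (kA1 Ab))) ab.
by apply: (A01 Aa); rewrite ab; exact: kA1.
Qed.

Let E' := adjoin E A0 k.

Lemma adjoin_sym x y : E' x y -> E' y x.
Proof.
move=> [/Es xy|[a Aa [xa ya]]|[a Aa [xa ya]]]; first by constructor 1.
  by constructor 3; exists a.
by constructor 2; exists a.
Qed.

Lemma adjoin_trans x y z : E' x y -> E' y z -> E' x z.
Proof.
move=> [xy|[a Aa [xa ya]]|[a Aa [ya xa]]] [yz|[b Ab [yb zb]]|[b Ab [zb yb]]].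
- by constructor 1; exact: Et yz.
- by constructor 2; exists b => //; split=> //; exact: Et xy yb.
- by constructor 3; exists b => //; split=> //; exact: Et xy yb.
- by constructor 2; exists a => //; split=> //; exact: Et (Es yz) ya.
- by case: (@Ene b a) => //; exact: Et (Es yb) ya.
- constructor 1; have E1 := Eeqk Aa Ab (Et (Es ya) yb).
  by apply: (Et xa); rewrite E1; exact: Es.
- by constructor 3; exists a => //; split=> //; exact: Et (Es yz) ya.
- constructor 1; have E1 := Eeq0 Aa Ab (Et (Es ya) yb).
  by apply: (Et xa); rewrite E1; exact: Es.
- by case: (@Ene a b) => //; exact: Et (Es ya) yb.
Qed.

Let sat : exists N, forall x y, agree N x y ->
  (forall a, A0 a -> E x a -> exists2 b, A0 b & E y b) /\
  (forall a, A1 a -> E x a -> exists2 b, A1 b & E y b).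
Proof.
have [N NP] := El p0; exists N => x y xy.
split=> a Aa xa; have [b ab b_y] := NP a x y (Es xa) xy; exists b;
  by [exact: d0 Aa|exact: d1 Aa|exact: Es].
Qed.

(** A link through [k] is lifted in stages: from [c'] along [E] into [A1], back by [k^-1] into [A0],
    and along [E] again to [x']; the opposite links use [k]. *)
Lemma adjoin_lift p : exists N, forall x c c', E' x c -> agree N c c' ->
  exists2 x', agree p x x' & E' x' c'.
Proof.
have [N NP] := El p.
have [q qP] := homeo_unif k^-1%g (maxn N p0).
have [N2 N2P] := El (maxn q p0).
have [r rP] := homeo_unif k N.
have [N3 N3P] := El (maxn r p0).
exists (maxn N (maxn N2 N3)) => x c c'.
have le1 : (N <= maxn N (maxn N2 N3))%N by rewrite !leq_max leqnn ?orbT.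
have le2 : (N2 <= maxn N (maxn N2 N3))%N by rewrite !leq_max leqnn ?orbT.
have le3 : (N3 <= maxn N (maxn N2 N3))%N by rewrite !leq_max leqnn ?orbT.
move=> [xc|[a Aa [xa ca]]|[a Aa [ca xa]]] cc'.
- have [x' xx' x'c'] := NP x c c' xc (agree_le le1 cc').
  by exists x' => //; constructor 1.
- have [d kad dc'] := N2P (k a) c c' (Es ca) (agree_le le2 cc').
  have A1d : A1 d.
    by apply: d1 (kA1 Aa); apply: agree_le kad; exact: leq_maxr.
  pose a' := k^-1%g d; have A0a' : A0 a' by apply/kA; rewrite homeo_VK.
  have aa' : agree (maxn N p0) a a'.
    rewrite -(homeo_K k a); apply: qP; apply: agree_le kad; exact: leq_maxl.
  have [x' xx' x'a'] := NP x a a' xa (agree_le (leq_maxl _ _) aa').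
  exists x' => //; constructor 2; exists a' => //; split=> //.
  by rewrite homeo_VK; exact: Es.
- have [a' aa' a'c'] := N3P a c c' (Es ca) (agree_le le3 cc').
  have A0a' : A0 a' by apply: d0 Aa; apply: agree_le aa'; exact: leq_maxr.
  have [|x' xx' x'a'] := NP x (k a) (k a') xa.
    by apply: rP; apply: agree_le aa'; exact: leq_maxl.
  by exists x' => //; constructor 3; exists a' => //; split=> //; exact: Es.
Qed.

(** Elements of [V m'] preserve the [E]-saturations of [A0] and [A1], so they cannot turn a link of
    [E] into a new one across the two; hence the inclusion. The only partner of [r a] in [A1] is
    [k (r a)], which forces the commutation. *)
Lemma adm_adjoin : exists m', [/\ adm E' m', slaved E' m' `<=` slaved E m &
  forall r a, slaved E' m' r -> A0 a -> r (k a) = k (r a)].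
Proof.
have [N NP] := sat; pose m' := maxn (maxn m p0) N.
have le1 : (m <= m')%N by rewrite !leq_max leqnn.
have le2 : (p0 <= m')%N by rewrite !leq_max leqnn ?orbT.
have le3 : (N <= m')%N by rewrite !leq_max leqnn ?orbT.
have adm' : adm E' m'.
  split=> [x|||x y xy|].
  - by constructor 1.
  - exact: adjoin_sym.
  - exact: adjoin_trans.
  - move=> [|[a Aa [xa ya]]|[a Aa [ya xa]]].
    + by apply: Ei; exact: agree_le xy.
    + have [/(_ a Aa xa)[b Ab yb] _] := NP x y (agree_le le3 xy).
      by case: (Ene Ab Aa); exact: Et (Es yb) ya.
    + have [/(_ a Aa ya)[b Ab xb] _] := NP y x (agree_sym (agree_le le3 xy)).
      by case: (Ene Ab Aa); exact: Et (Es xb) xa.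
  - exact: adjoin_lift.
have sub r x y : slaved E' m' r -> E x y -> E (r x) (r y).
  have cross u v a : agree m' (r u) u -> agree m' (r v) v -> E u v ->
      A0 a -> E (r u) a -> E (r v) (k a) -> False.
    move=> uu vv uv Aa ua va.
    have [/(_ a Aa ua)[b Ab ub] _] := NP _ _ (agree_le le3 uu).
    have [_ /(_ _ (kA1 Aa) va)[d A1d vd]] := NP _ _ (agree_le le3 vv).
    have bd : b = d.
      by apply: CE (A0C Ab) (A1C A1d) _; exact: Et (Es ub) (Et uv vd).
    by apply: (A01 Ab); rewrite bd.
  move=> [Vr Er'] xy; have : E' (r x) (r y) by apply: (iffLR (Er' x y)); constructor 1.
  move=> [//|[a Aa [xa ya]]|[a Aa [ya xa]]].
    by case: (cross x y a).
  by case: (cross y x a) => //; exact: Es.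
exists m'; split=> // [r rR|r a rR Aa].
  have [Vr _] := rR; split; first exact: V_le Vr.
  move=> x y; split; first exact: sub.
  have [_ _ /(_ r rR) rVR] := subgp_slaved E' m'.
  by move=> /(sub _ _ _ rVR); rewrite !homeo_K.
have [Vr Er'] := rR.
have A0ra : A0 (r a) by apply: d0 Aa; apply/agree_sym; exact: agree_le (Vr a).
have A1rka : A1 (r (k a)).
  by apply: d1 (kA1 Aa); apply/agree_sym; exact: agree_le (Vr (k a)).
have : E' (r a) (r (k a)).
  by apply: (iffLR (Er' a (k a))); constructor 2; exists a.
move=> [H|[b Ab [rab rkab]]|[b Ab [rkab _]]].
- by case: (A01 A0ra); rewrite (CE (A0C A0ra) (A1C A1rka) H).
- rewrite (CE (A1C A1rka) (A1C (kA1 Ab)) rkab).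
  by rewrite (CE (A0C A0ra) (A0C Ab) rab).
- case: (A01 Ab); suff <- : r (k a) = b by [].
  exact: CE (A1C A1rka) (A0C Ab) rkab.
Qed.

End Adjoin.

(** * Cosets of subgroups that are not open *)

Definition dense_in (n : nat) (K : set G) :=
  forall phi m, V n phi -> exists2 k, K k & V m (phi^-1 * k)%g.

Definition thin (K : set G) := forall M, ~ (V M `<=` K).

(** This is [v^-1 K v]; it turns the ratios [v * s * r * v^-1] of a scheme into products [s * r]. *)
Definition conj_set (v : G) (K : set G) : set G := [set g | K (v * g * v^-1)%g].

Lemma subgp_conj v K : is_subgp K -> is_subgp (conj_set v K).
Proof.
move=> [K1 KM KV]; split=> [|f g Kf Kg|g Kg]; rewrite /conj_set /=.
- by rewrite mulg1 mulgV.
- have -> : (v * (f * g) * v^-1 = v * f * v^-1 * (v * g * v^-1))%g.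
    by rewrite !mulgA mulgVK.
  exact: KM.
- have -> : (v * g^-1 * v^-1 = (v * g * v^-1)^-1)%g.
    by rewrite !invgM invgK mulgA.
  exact: KV.
Qed.

Lemma dense_conj v K n : dense_in n K -> exists n', dense_in n' (conj_set v K).
Proof.
move=> Kn; have [n' n'P] := V_conj v n; exists n' => phi m Vphi.
have [p pP] := V_conj v^-1%g m; have [k Kk Vk] := Kn _ p (n'P _ Vphi).
exists (v^-1 * k * v)%g.
  by rewrite /conj_set /= -mulgA mulgK !mulgA mulgV mul1g.
have := pP _ Vk; congr (V m _).
by rewrite !invgM !invgK !mulgA mulVg mul1g.
Qed.

Lemma thin_conj v K : thin K -> thin (conj_set v K).
Proof.
move=> Kt M VK; have [M' M'P] := V_conj v^-1%g M; apply: (Kt M') => g Vg.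
have := VK _ (M'P _ Vg).
by rewrite /conj_set /= invgK !mulgA mulgV mul1g mulgK.
Qed.

Lemma set_exp_subgp K n : is_subgp K -> set_exp K n `<=` K.
Proof.
move=> [K1 KM _] g [w wK <-].
by elim/big_ind: _ => // i _; exact: wK.
Qed.

(* The element [g k^-1 g^-1 k] of [K] equals [h] on [A0], for [g] in [s R'] and
   [R'] the elements of [slaved E m] that commute with [k] on [A0]. *)
Lemma slaved_avoid E m n K : adm E m -> is_subgp K -> dense_in n K -> thin K ->
  exists s E' m', [/\ slaved E m s, adm E' m', slaved E' m' `<=` slaved E m &
    forall r, slaved E' m' r -> ~ K (s * r)%g].
Proof.
move=> admE Kg Kn Kt; have [N NP] := slaved_extend admE.
have [C [N1 [NN1 dC hC Cthin CE]]] := adm_transversal admE n (maxn N n).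
have [NN nN] : (N <= N1)%N /\ (n <= N1)%N.
  by split; apply: leq_trans NN1; rewrite ?leq_maxl ?leq_maxr.
pose A b := C `&` [set x | x N1 = b].
have dC1 : det N1.+1 C by apply: det_le dC.
have dA b : det N1.+1 (A b) by apply: detI dC1 _; exact: det_bit.
have hA b : hits n (A b).
  move=> x; have [y xy Cy] := hC x; exists (set_bit N1 b y).
    by apply: agree_trans xy _; exact: set_bit_agree.
  split; last exact: set_bit_eq.
  by apply: dC Cy; exact: set_bit_agree.
have hnA b : hits n (~` A b).
  move=> x; exists (set_bit N1 (~~ b) x); first exact: set_bit_agree.
  by move=> [_]; rewrite /= set_bit_eq; case: b.
(* [K] is dense in [V n] but contains no [V M], so by [full_open] it is not full on [A false]. *)
have [h [Vh hA0 hK]] : exists h, [/\ V n h, supp h (A false) &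
    forall g, K g -> ~ forall x, A false x -> g x = h x].
  have [phi [psi [p [M [Vphi Vpsi H]]]]] :=
    full_open (dA false) (hA false) (hnA false).
  apply: contrapT => nh; apply: (Kt M).
  have [K1 KM KV] := Kg; apply: subset_trans (set_exp_subgp (n := 18) Kg).
  apply: H => //; [|exact: Kn|exact: Kn].
  move=> h Vh hA0; apply: contrapT => ng; apply: nh; exists h; split=> // g Kg' gh.
  by apply: ng; exists g.
(* [C] has a single cylinder of level [N1] inside each cylinder of level [n], so on [C] keeping
   level [n] amounts to keeping level [N1]. *)
have VNh : V N h.
  move=> x; have [Ax|nAx] := pselect (A false x); last by rewrite hA0.
  have [Chx _] := supp_stable hA0 Ax; have [Cx _] := Ax.
  by apply: (agree_le NN); apply: Cthin => //; exact: Vh.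
have [v Vv vA] := move_set (leqW nN) (dA false) (dA true) (hA false) (hnA false)
  (hA true) (hnA true).
have [k Kk Vk] := Kn v N1.+1 Vv.
have kA x : A true (k x) <-> A false x.
  rewrite -[k](mulVKg v) mul_homeoE vA; split; apply: dA; last apply: agree_sym.
    exact: Vk.
  exact: Vk.
have A01 x : A false x -> ~ A true x by move=> [_ /= x0] [_ /=]; rewrite x0.
have AC b : A b `<=` C by move=> x [].
have [m' [adm' sub comm]] :=
  adm_adjoin admE CE (AC false) (AC true) A01 (dA false) (dA true) kA.
have [s sE sh] := NP C h N1 dC CE (supp_sub (AC false) hA0) VNh.
exists s, (adjoin E (A false) k), m'; split=> // r rR Ksr.
have [K1 KM KV] := Kg.
apply: (hK (s * r * k^-1 * (s * r)^-1 * k)%g).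
  exact: (KM _ _ (KM _ _ (KM _ _ Ksr (KV _ Kk)) (KV _ Ksr)) Kk).
move=> x Ax.
have skx : s^-1%g (k x) = k x.
  have Akx : A true (k x) by apply/kA.
  apply: (@homeo_inj s); rewrite homeo_VK sh; last exact: AC Akx.
  by rewrite hA0 // => /A01.
have [_ _ /(_ r rR) rVR] := subgp_slaved (adjoin E (A false) k) m'.
rewrite invgM !mul_homeoE skx comm // homeo_K homeo_VK sh //.
by case: Ax.
Qed.

(** As [K] is not dense in [V n], some [phi V q] with [phi] in [V n] misses it; [s] is the conjugate
    [v^-1 * phi * v], and [n] is chosen to put it in [V m]. *)
Lemma nowhere_dense_avoid K v m : ~ (exists n, dense_in n K) ->
  exists s p, [/\ V m s, (m <= p)%N &
    forall r, V p r -> ~ K (v * s * r * v^-1)%g].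
Proof.
move=> nK; have [n nP] := V_conj v^-1%g m.
have [phi [q [Vphi phiK]]] : exists phi q, V n phi /\
    forall k, K k -> ~ V q (phi^-1 * k)%g.
  apply: contrapT => H; apply: nK; exists n => phi q Vphi.
  apply: contrapT => H'; apply: H; exists phi, q; split=> // k Kk Vk.
  by apply: H'; exists k.
have [p pP] := V_conj v q; exists (v^-1 * phi * v)%g, (maxn m p); split.
- by have := nP _ Vphi; rewrite invgK.
- exact: leq_maxl.
- move=> r Vr /phiK; apply.
  have -> : (phi^-1 * (v * (v^-1 * phi * v) * r * v^-1) = v * r * v^-1)%g.
    by rewrite !mulgA mulgK mulVg mul1g.
  by apply: pP; apply: V_le Vr; exact: leq_maxr.
Qed.

(** The conditions are the groups [slaved E m]; a node is split by [slaved_avoid] for the conjugate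
    of [K l] by its centre. At levels outside [D] nothing is to be avoided and [s = 1] is taken. *)
Lemma slaved_scheme (K : nat -> set G) (D : set nat) :
    (forall l, D l -> [/\ is_subgp (K l), thin (K l) & exists n, dense_in n (K l)]) ->
  exists h : X -> G,
    (forall l a b, agree l a b -> V l ((h a)^-1 * h b)%g) /\
    (forall l a b, D l -> agree l a b -> a l = false -> b l = true ->
      ~ K l (h b * (h a)^-1)%g).
Proof.
move=> KD; pose RR : set (set G) := fun R => exists E m, adm E m /\ R = slaved E m.
have [||||h [hV hK]] := @cantor_scheme RR (fun l => [set g | D l /\ K l g]).
- by exists (slaved eq 0), eq, 0; split=> //; exact: adm_eq.
- move=> R [E [m [admE ->]]]; split; first exact: subgp_slaved.
  exact: seq_closed_slaved.
- move=> R n [E [m [admE ->]]]; exists (slaved E (maxn m n)).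
    by exists E, (maxn m n); split=> //; apply: adm_le admE; exact: leq_maxl.
  move=> g gE; split; first by apply: slaved_le gE; exact: leq_maxl.
  by case: gE => Vg _; apply: V_le Vg; exact: leq_maxr.
- move=> l v R [E [m [admE ->]]].
  have [Dl|nDl] := pselect (D l); last first.
    exists 1%g, (slaved E m); split=> //.
    + by exists E, m.
    + by move=> r _ [].
  have [Kg Kt [n Kn]] := KD l Dl; have [n' Kn'] := dense_conj v Kn.
  have [s [E' [m' [sE adm' sub sK]]]] :=
    slaved_avoid admE (subgp_conj v Kg) Kn' (thin_conj (v := v) Kt).
  exists s, (slaved E' m'); split=> //; first by exists E', m'.
  by move=> r /sK nK [_ Kr]; apply: nK; rewrite /conj_set /= mulgA.
exists h; split=> // l a b Dl ab al bl Kab.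
by apply: (hK l a b).
Qed.

(** If [K] is dense in some [V n] the conditions are slaved groups, otherwise the groups [V m]
    suffice. Distinct [a] and [b] are compared at their first differing bit. *)
Lemma thin_scheme K : is_subgp K -> thin K ->
  exists h : X -> G, forall a b, a <> b -> ~ K (h b * (h a)^-1)%g.
Proof.
move=> Kg Kt; have [K1 KM KV] := Kg.
suff [h hK] : exists h : X -> G, forall l a b, agree l a b -> a l = false ->
    b l = true -> ~ K (h b * (h a)^-1)%g.
  exists h => a b ab Kab.
  have /ex_minnP[l abl lmin] : exists l, a l != b l.
    apply: contrapT => nab; apply: ab; apply/funext => l.
    by apply/eqP/negPn/negP => abl; apply: nab; exists l.
  have agr : agree l a b.
    move=> i il; apply/eqP/negPn/negP => /lmin.
    by rewrite leqNgt il.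
  case al: (a l); case bl: (b l); rewrite al bl // in abl.
    apply: (hK l b a) => //; first exact: agree_sym.
    by have := KV _ Kab; rewrite invgM invgK.
  by apply: (hK l a b).
have [Kd|Knd] := pselect (exists n, dense_in n K).
  have [|h [_ hK]] := @slaved_scheme (fun=> K) setT; first by [].
  by exists h => l a b; exact: hK.
pose RR : set (set G) := fun R => exists m, R = V m.
have [||||h [_ hK]] := @cantor_scheme RR (fun=> K); last by exists h.
- by exists (V 0), 0.
- by move=> R [m ->]; split; [exact: subgp_V|exact: seq_closed_V].
- move=> R n [m ->]; exists (V (maxn m n)); first by exists (maxn m n).
  by move=> g Vg; split; apply: V_le Vg; rewrite ?leq_maxl ?leq_maxr.
- move=> l v R [m ->]; have [s [p [Vs mp sK]]] := nowhere_dense_avoid v m Knd.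
  exists s, (V p); split=> //; first by exists p.
  by move=> g; exact: V_le.
Qed.

Lemma is_subgroupP (K : set G) : is_subgroup K -> is_subgp K.
Proof.
move=> KG; split.
- by have [/set_mem] := KG.
- by move=> f g /mem_set Kf /mem_set Kg; apply/set_mem/group_closedM.
- by move=> g /mem_set Kg; apply/set_mem/group_closedV.
Qed.

Lemma thin_not_open (K : set G) : is_subgp K -> ~ open K -> thin K.
Proof.
by move=> [_ KM _] nK M VK; apply: nK; exact: open_subgroup VK.
Qed.

(** Since [thin_scheme] controls [h b * (h a)^-1], it is the inverses [(h a)^-1] that lie in
    distinct left cosets. *)
Lemma small_index (K : set G) : is_subgroup K -> index_lt_continuum K -> open K.
Proof.
move=> /is_subgroupP Kg [Kle /negP Kne]; apply: contrapT => nK.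
have [h hK] := thin_scheme Kg (thin_not_open Kg nK).
apply: Kne; rewrite card_eq_le Kle /=.
pose F (a : nat -> bool) := left_coset (h a)^-1%g K.
have Finj : injective F.
  move=> a b Fab; apply: contrapT => /hK nKab; have [K1 KM KV] := Kg.
  have : F a (h a)^-1%g by exists 1%g => //; rewrite mulg1.
  rewrite Fab => -[k Kk E]; apply: nKab.
  by rewrite -E mulVKg.
have /card_eqPle[_ le1] : F @` setT #= [set: nat -> bool].
  by apply: inj_card_eq => a b _ _; exact: Finj.
apply: card_le_trans le1 _; apply: subset_card_le => _ [a _ <-].
by exists (h a)^-1%g.
Qed.

Lemma baire_cantor (A : nat -> set X) :
    (forall i x n, exists y n', agree n x y /\ forall z, agree n' y z -> A i z) ->
  exists a, forall i, A i a.
Proof.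
move=> HA.
have /choice[f fP] (ixn : nat * (X * nat)) : exists yn : X * nat,
    [/\ agree ixn.2.2 ixn.2.1 yn.1, (ixn.2.2 <= yn.2)%N, (ixn.1 < yn.2)%N &
      forall z, agree yn.2 yn.1 z -> A ixn.1 z].
  case: ixn => i [x n] /=; have [y [n' [xy yA]]] := HA i x n.
  exists (y, maxn n' (maxn n i.+1)); split=> //=.
  - by rewrite !leq_max leqnn ?orbT.
  - by rewrite !leq_max leqnn ?orbT.
  - by move=> z yz; apply: yA; apply: agree_le yz; exact: leq_maxl.
pose s := fix s i : X * nat :=
  if i is k.+1 then f (k, s k) else ((fun=> false) : X, 0).
have sP i := fP (i, s i).
have sle i d : ((s i).2 <= (s (i + d)%N).2)%N /\
    agree (s i).2 (s i).1 (s (i + d)%N).1.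
  elim: d => [|d [IH1 IH2]]; first by rewrite addn0.
  have [H1 H2 _ _] := sP (i + d)%N; rewrite addnS; split.
    exact: leq_trans H2.
  by apply: agree_trans IH2 _; apply: agree_le H1.
(* Bit [j] is settled at stage [j.+1], whose level exceeds [j]. *)
exists (fun j => (s j.+1).1 j) => i; have [_ _ H1 H2] := sP i.
apply: H2 => j ij; have [_ _ jj _] := sP j.
have [ji|/ltnW ij'] := leqP j.+1 i.+1.
  have [_ H] := sle j.+1 (i.+1 - j.+1)%N; rewrite subnKC // in H.
  exact/esym/H.
have [_ H] := sle i.+1 (j.+1 - i.+1)%N; rewrite subnKC // in H.
exact: H.
Qed.

(* By Kuratowski-Ulam, a generic translate of the Cantor set [h] meets each
   nowhere dense coset in a meager set; it meets the cosets of the other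
   subgroups, each of which is avoided at infinitely many levels of the
   scheme, in nowhere dense sets. *)
Lemma cosets_not_cover (K : nat -> set G) (g : nat -> G) :
    (forall i, is_subgp (K i)) -> (forall i, thin (K i)) ->
  exists x, forall i, ~ K i (x * (g i)^-1)%g.
Proof.
(* The 2-adic valuation of [l.+1] takes every value infinitely often, so each [K i] has its turn at
   arbitrarily deep levels. *)
move=> Kg Kt; pose ix l := logn 2 l.+1.
have ixP i n : exists2 l, (n <= l)%N & ix l = i.
  have pos : (0 < 2 ^ i * n.*2.+1)%N by rewrite muln_gt0 expn_gt0.
  exists (2 ^ i * n.*2.+1).-1; last first.
    rewrite /ix prednK // lognM ?expn_gt0 // pfactorK // logn_coprime ?addn0 //.
    by rewrite prime_coprime // dvdn2 /= odd_double.
  rewrite -ltnS prednK //; apply: leq_trans (leq_pmull _ _); last first.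
    by rewrite expn_gt0.
  by rewrite ltnS -addnn leq_addr.
have [|h [hV hK]] := @slaved_scheme (fun l => K (ix l))
    [set l | exists n, dense_in n (K (ix l))].
  by move=> l Dl; split.
pose pt (t : seq bool) : X := fun j => nth false t j.
pose cleared i (u : G) (x : X) n := exists y n', agree n x y /\
  forall z, agree n' y z -> ~ K i (h z * u * (g i)^-1)%g.
(* For a generic [u], each nowhere dense [K i] and each finite word [t], coded together by [j], the
   points [h z * u] avoid the coset for all [z] in some cylinder inside that of [t]. *)
have [|u uP] := @baire_homeo (fun j => [set u : G |
    if unpickle j is Some (i, t) then ~ (exists n, dense_in n (K i)) ->
      cleared i u (pt t) (size t) else True]).
  move=> j w m; rewrite /=; case: unpickle => [[i t]|]; last first.
    by exists 1%g, 0; split=> //; exact: V1.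
  have [Kd|Knd] := pselect (exists n, dense_in n (K i)).
    by exists 1%g, 0; split=> //; exact: V1.
  pose a := pt t; have [K1 KM KV] := Kg i.
  have [u [p [Vu up]]] : exists u p, V m u /\ forall r, V p r ->
      ~ K i (h a * w * u * r * (g i)^-1)%g.
    have [[u0 [Vu0 Ku0]]|nu0] := pselect (exists u0, V m u0 /\
        K i (h a * w * u0 * (g i)^-1)%g); last first.
      exists 1%g, m; split=> [|r Vr Kr]; first exact: V1.
      by apply: nu0; exists r; rewrite mulg1 in Kr.
    (* [u0] hits the coset; a further factor [s] leaves it, since the quotient of two elements of
       the coset would lie in [K i]. *)
    have [s [p [Vs _ sK]]] := nowhere_dense_avoid (g i) m Knd.
    exists (u0 * s)%g, p; split=> [|r /sK nK Kr]; first exact: VM.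
    apply: nK; have := KM _ _ (KV _ Ku0) Kr.
    have -> : (h a * w * (u0 * s) * r * (g i)^-1 =
        h a * w * u0 * (g i)^-1 * (g i * s * r * (g i)^-1))%g.
      by rewrite !mulgA mulgVK.
    by rewrite mulKg.
  have [q qP] := V_conj (w * u)^-1%g p.
  exists u, p; split=> // r Vr _; exists a, q; split=> // z az.
  have := up _ (VM (qP _ (hV _ _ _ az)) Vr); congr (~ K i _).
  rewrite -(mulgA (h a) w u) invgK; move: (w * u)%g => b.
  by rewrite !mulgA mulgK mulgV mul1g.
have clear_all i x n : cleared i u x n.
  have [[k Kk]|Knd] := pselect (exists n, dense_in n (K i)); last first.
    have := uP (pickle (i, mkseq x n)); rewrite /= pickleK => /(_ Knd).
    move=> [y [n' [xy yK]]]; exists y, n'; split=> // j jn.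
    by rewrite -xy ?size_mkseq // /pt nth_mkseq.
  (* At a level [l] devoted to [K i], points of the coset over both values of bit [l] would have
     their ratio in [K i], so one of the two subcylinders is free of them. *)
  have [l nl li] := ixP i n.
  have [H|H] := pselect (forall z, agree l.+1 (set_bit l false x) z ->
      ~ K i (h z * u * (g i)^-1)%g).
    by exists (set_bit l false x), l.+1; split=> //; exact: set_bit_agree.
  exists (set_bit l true x), l.+1; split; first exact: set_bit_agree.
  move=> z1 xz1 Kz1; apply: H => z0 xz0 Kz0; have [K1 KM KV] := Kg i.
  apply: (hK l z0 z1).
  - by rewrite /= li; exists k.
  - apply: agree_trans (agree_sym (agree_le (leqnSn l) xz0)) _.
    apply: agree_trans (agree_sym (set_bit_agree _ _ (leqnn l))) _.
    apply: agree_trans (set_bit_agree true _ (leqnn l)) _.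
    exact: agree_le xz1.
  - by rewrite -(xz0 l) // set_bit_eq.
  - by rewrite -(xz1 l) // set_bit_eq.
  rewrite li; have := KM _ _ Kz1 (KV _ Kz0).
  by rewrite !invgM invgK !mulgA mulgVK mulgK.
have [i x n|a aP] := @baire_cantor (fun i => [set a | ~ K i (h a * u * (g i)^-1)%g]).
  exact: clear_all.
by exists (h a * u)%g.
Qed.

Lemma not_union_of_cosets : ~ exists C : set (set G),
  [/\ countable C,
    (forall A, C A -> exists K : set G,
      [/\ is_subgroup K, ~ open K & is_coset K A]) &
    [set: G] = \bigcup_(A in C) A].
Proof.
move=> [C [cC CK Ccov]].
have /pfcard_geP[C0|[d]] := cC.
  have : (\bigcup_(A in C) A) 1%g by rewrite -Ccov.
  by rewrite C0 => -[A []].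
have /choice[Kg KgP] i : exists Kg : set G * G,
    [/\ is_subgp Kg.1, thin Kg.1 & forall x, d i x -> Kg.1 (x * Kg.2^-1)%g].
  have Cd : C (d i) by apply: (@funS _ _ _ _ d).
  have [K [/is_subgroupP Ks nK [g [E|E]]]] := CK _ Cd.
    (* A left coset [g K] is the right coset of [g K g^-1] through [g]. *)
    exists (conj_set g^-1%g K, g); split=> /=; first exact: subgp_conj.
      by apply: thin_conj; exact: thin_not_open.
    move=> x; rewrite E => -[k Kk <-].
    by rewrite /conj_set /= invgK !mulgA mulVg mul1g mulgVK.
  exists (K, g); split=> //=; first exact: thin_not_open.
  by move=> x; rewrite E => -[k Kk <-]; rewrite mulgK.
have [x xK] := @cosets_not_cover (fun i => (Kg i).1) (fun i => (Kg i).2)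
  (fun i => let: And3 H _ _ := KgP i in H) (fun i => let: And3 _ H _ := KgP i in H).
have [A CA Ax] : (\bigcup_(A in C) A) x by rewrite -Ccov.
have [i _ di] : (d @` setT) A by apply: (@surj _ _ _ _ d).
by apply: (xK i); have [_ _] := KgP i; apply; rewrite di.
Qed.

Theorem corollary1p2 :
  [/\ (forall K : set (homeo cantor_space),
         is_subgroup K -> index_lt_continuum K -> open K),
      (~ exists C : set (set (homeo cantor_space)),
         [/\ countable C,
             (forall A, C A -> exists K : set (homeo cantor_space),
                [/\ is_subgroup K, ~ open K & is_coset K A]) &
             [set: homeo cantor_space] = \bigcup_(A in C) A]),
      (forall (G : topologicalGroupType)
              (f : {multiplicative homeo cantor_space -> G}),
         separable G -> continuous f) &
      (forall W : nat -> set (homeo cantor_space),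
         (forall k, W k `<=` W k.+1) ->
         [set: homeo cantor_space] = \bigcup_k W k ->
         exists n k, [set: homeo cantor_space] = set_exp (W k) n)].
Proof.
split; [exact: small_index|exact: not_union_of_cosets| |exact: bergman].
by move=> H f; exact: automatic_continuity.
Qed.
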